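(* There exists a universal constant $c>0$ such that, for any probability space $X=(\Omega,\mathcal F,P)$, any finite set $E$, and any event $A\in\mathcal F^E$ satisfying $\mathbb P(A)\in(0,1)$, $$\sum_{e\in E}I_A(e)\ \ge\ c\,\mathbb P(A)\,(1-\mathbb P(A))\,\log(1/m),$$ where $m=\max_{e\in E}I_A(e)$.
   Context: For a probability space $X=(\Omega,\mathcal F,P)$ and a finite set $E$, $X^E=(\Omega^E,\mathcal F^E,\mathbb P=P^E)$ denotes the product probability space of $|E|$ copies of $X$ indexed by $E$ ($\mathcal F^E$ is the product $\sigma$-field; no completeness or separability is assumed). For $e\in E$ and $\psi\in\Omega^{E\setminus\{e\}}$, the fibre is $F_\psi=\{\omega\in\Omega^E:\omega(f)=\psi(f)\text{ for } f\neq e\}\simeq\{\psi\}\times\Omega$. Via the identification $F_\psi\simeq\Omega$ (by $\omega\mapsto\omega(e)$), for $A\in\mathcal F^E$ write $P(A\cap F_\psi)$ for the $P$-measure of the section $\{\omega(e):\omega\in A\cap F_\psi\}\subseteq\Omega$. The influence of $e\in E$ on $A\in\mathcal F^E$ is $$I_A(e)=P^{E\setminus\{e\}}\bigl(\{\psi\in\Omega^{E\setminus\{e\}}:0<P(A\cap F_\psi)<1\}\bigr).$$ *)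

(* Defs.v *)
From HB Require Import structures.
From mathcomp Require Import all_boot all_order all_algebra.
From mathcomp Require Import all_classical all_reals all_analysis.

Set Implicit Arguments.
Unset Strict Implicit.
Unset Printing Implicit Defensive.

Import Order.TTheory GRing.Theory Num.Theory.
Import numFieldNormedType.Exports.

Local Open Scope classical_set_scope.
Local Open Scope ring_scope.
Local Open Scope ereal_scope.

(* The set T^I, as an alias of [I -> T] so as to carry the product
   sigma-algebra. *)
Definition config (I : finType) (T : Type) : Type := I -> T.

Definition config_display : measure_display -> measure_display.
Proof. exact. Qed.

Section config_measurable.
Context d (T : measurableType d) (I : finType).

Definition coordinate_sets : set (set (config I T)) :=
  \bigcup_(i in [set: I])
    preimage_set_system setT (fun w : config I T => w i) measurable.

Let config_set0 : <<s coordinate_sets >> set0.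
Proof. exact: sigma_algebra0. Qed.

Let config_setC A : <<s coordinate_sets >> A -> <<s coordinate_sets >> (~` A).
Proof. exact: sigma_algebraC. Qed.

Let config_bigcup (F : (set (config I T))^nat) :
  (forall i, <<s coordinate_sets >> (F i)) ->
  <<s coordinate_sets >> (\bigcup_i F i).
Proof. exact: sigma_algebra_bigcup. Qed.

HB.instance Definition _ := Pointed.copy (config I T) (I -> T).
HB.instance Definition _ := @isMeasurable.Build (config_display d)
  (config I T) <<s coordinate_sets >> config_set0 config_setC config_bigcup.

Lemma measurable_coordinate (i : I) :
  measurable_fun setT (fun w : config I T => w i).
Proof.
by move=> _ Y mY; rewrite setTI; apply: sub_sigma_algebra; exists i => //;
  exists Y => //; rewrite setTI.
Qed.

Lemma measurable_fun_config d' (S : measurableType d') (f : S -> config I T) :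
  (forall i, measurable_fun setT (fun x => f x i)) -> measurable_fun setT f.
Proof.
move=> mf; apply: (@measurability _ _ _ _ _ _ coordinate_sets) => //.
by move=> _ [_ [i _ [B mB <-]] <-]; rewrite !setTI; have := mf i measurableT B mB;
  rewrite setTI.
Qed.

End config_measurable.

Section tuple_power.
Context d (T : measurableType d) (R : realType) (P : probability T R).

Definition tuple_cons n (x : T * n.-tuple T) : n.+1.-tuple T :=
  [tuple of x.1 :: x.2].

Lemma measurable_tuple_cons n : measurable_fun setT (@tuple_cons n).
Proof. exact: measurable_cons. Qed.

HB.instance Definition _ n :=
  isMeasurableFun.Build _ _ _ _ (@tuple_cons n) (@measurable_tuple_cons n).

(* P^n on T^n, by recursion: P^(n+1) is the image of P \x P^n under cons. *)
Fixpoint tuple_power n : probability (n.-tuple T) R :=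
  if n is m.+1 return probability (n.-tuple T) R
  then distribution (P \x tuple_power m) (@tuple_cons m)
  else \d_([tuple] : 0.-tuple T).

Lemma tuple_power_box n (B : 'I_n -> set T) :
  (forall i, measurable (B i)) ->
  tuple_power n [set t | forall i, B i (tnth t i)] = \prod_(i < n) P (B i).
Proof.
elim: n B => [|n IH] B mB /=.
  by rewrite big_ord0 diracE mem_set// => -[].
rewrite big_ord_recl /distribution /pushforward/=.
rewrite (_ : _ @^-1` _ =
   B ord0 `*` [set t | forall i, B (lift ord0 i) (tnth t i)]); last first.
  apply/seteqP; split=> [[x t] /= H|[x t] /= [H0 H] i].
    by split=> [|i]; [exact: (H ord0)|have := H (lift ord0 i); rewrite tnthS].
  by case: (unliftP ord0 i) => [j ->|->]; [rewrite tnthS|].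
rewrite product_measure1E//; first by congr (_ * _); exact: (IH (fun i => B (lift ord0 i))).
rewrite (_ : mkset _ =
  \bigcap_(i in [set: 'I_n]) (fun t => tnth t i) @^-1` B (lift ord0 i)).
  apply: fin_bigcap_measurable; [exact: finite_finset|move=> i _]; rewrite -[_ @^-1` _]setTI.
  exact: measurable_tnth.
by apply/seteqP; split=> t /= H i => [_|]; exact: H.
Qed.

End tuple_power.

Section power.
Context d (T : measurableType d) (R : realType) (P : probability T R).
Variable I : finType.

Definition config_of_tuple (t : #|I|.-tuple T) : config I T :=
  fun i => tnth t (enum_rank i).

Lemma measurable_config_of_tuple : measurable_fun setT config_of_tuple.
Proof. by apply: measurable_fun_config => i; exact: measurable_tnth. Qed.

HB.instance Definition _ := isMeasurableFun.Build _ _ _ _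
  config_of_tuple measurable_config_of_tuple.

(* The product probability P^I; [power_unique] below shows that it does not
   depend on the enumeration of I. *)
Definition power : probability (config I T) R :=
  distribution (tuple_power P #|I|) config_of_tuple.

Lemma power_box (B : I -> set T) : (forall i, measurable (B i)) ->
  power [set w | forall i, B i (w i)] = \prod_(i : I) P (B i).
Proof.
move=> mB.
transitivity (tuple_power P #|I|
    [set t | forall j, B (enum_val j) (tnth t j)]); last first.
  rewrite (tuple_power_box P (B := fun j => B (enum_val j)))//.
  by rewrite [RHS](reindex _ (onW_bij _ (@enum_val_bij I))).
congr (tuple_power P _ _); apply/seteqP; split=> t /= H i.
  by have := H (enum_val i); rewrite /config_of_tuple enum_valK.
by have := H (enum_rank i); rewrite enum_rankK.
Qed.

Lemma power_unique (Q : {measure set (config I T) -> \bar R}) :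
  (forall B : I -> set T, (forall i, measurable (B i)) ->
    Q [set w | forall i, B i (w i)] = \prod_(i : I) P (B i)) ->
  forall A, measurable A -> Q A = power A.
Proof.
move=> QE A mA.
pose G : set (set (config I T)) := [set C | exists2 B : I -> set T,
  (forall i, measurable (B i)) & C = [set w | forall i, B i (w i)]].
apply: (measure_unique G (fun=> setT)) => //.
- apply/seteqP; split; last first.
    apply: smallest_sub; first exact: sigma_algebra_measurable.
    move=> _ [B mB ->].
    rewrite (_ : mkset _ =
      \bigcap_(i in [set: I]) (fun w : config I T => w i) @^-1` B i).
      apply: fin_bigcap_measurable; [exact: finite_finset|move=> i _]; rewrite -[_ @^-1` _]setTI.
      exact: measurable_coordinate.
    by apply/seteqP; split=> w /= H i => [_|]; exact: H.
  apply: smallest_sub; first exact: smallest_sigma_algebra.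
  move=> _ [i _ [B mB <-]]; apply: sub_sigma_algebra.
  exists (fun j => if j == i then B else setT); first by move=> j; case: eqP.
  apply/seteqP; split=> w /=; first by move=> [_ Bw] j; case: eqP => // ->.
  by move=> /(_ i); rewrite eqxx.
- move=> _ _ [B mB ->] [C mC ->]; exists (fun i => B i `&` C i).
    by move=> i; exact: measurableI.
  apply/seteqP; split=> w /=; first by move=> [HB HC] i; split.
  by move=> H; split=> i; have [] := H i.
- by move=> _; exists (fun=> setT) => //; apply/seteqP.
- by rewrite bigcup_const.
- by move=> _ [B mB ->]; rewrite (QE _ mB); symmetry; exact: power_box.
- move=> _; rewrite (_ : setT = [set w | forall i : I, [set: T] (w i)]).
    by rewrite (QE (fun=> setT))// big1 ?ltry// => i _; rewrite probability_setT.
  by apply/seteqP.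
Qed.

End power.

Section influence.
Context d (T : measurableType d) (R : realType) (P : probability T R).
Variable E : finType.

Definition fibre (e : E) (psi : config {f : E | f != e} T) :
  set (config E T) := [set w | forall f : {f : E | f != e}, w (val f) = psi f].

(* P(A \cap F_psi), the fibre being identified with T through w |-> w e. *)
Definition fibre_prob (A : set (config E T)) (e : E)
    (psi : config {f : E | f != e} T) : \bar R :=
  P [set w e | w in A `&` fibre psi].

Definition influence (A : set (config E T)) (e : E) : \bar R :=
  power P {f : E | f != e} [set psi | 0 < fibre_prob A psi < 1].

(* All influences are nonnegative, so the default 0 matters only if E is
   empty, in which case every event has probability 0 or 1. *)
Definition max_influence (A : set (config E T)) : \bar R :=
  \big[maxe/0]_(e : E) influence A e.

End influence.

(* Main.v *)
Require Import Defs.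
From HB Require Import structures.
From mathcomp Require Import all_boot all_order all_algebra.
From mathcomp Require Import perm ring lra zify.

(* Draw [2 ^ k] independent samples of every coordinate:
   the event becomes a random subset [G] of the finite grid [[2 ^ k] ^ E].
   Almost surely the combinatorial influences of [G] are at most the densities
   of the sampled nontrivial fibres, and since two grid points without a common
   coordinate are independent, the first two moments of these densities and of
   the density of [G] tend to those of the original problem as [k] grows.  So it
   suffices to prove an inequality quadratic in the influences on the grid.

   There, compressions make [G] monotone without changing its size or increasing
   its influences.  Every fibre is then a final segment for the binary order,
   so that flipping the bit of weight [2 ^ b] matters with conditional
   probability at most [2 ^ b.+1 / 2 ^ k]; these sum to at most 2, and the
   Kahn-Kalai-Linial argument on the cube of bits (hypercontractivity of the
   noise operator applied to the discrete derivatives) applies. *)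

Set Implicit Arguments.
Unset Strict Implicit.
Unset Printing Implicit Defensive.
Import Order.TTheory GRing.Theory Num.Theory.
Local Open Scope ring_scope.

(** * Fourier analysis on the cube *)

Section average.
Context {R : realFieldType} {Z : finType}.

Definition avg (F : Z -> R) : R := (\sum_z F z) / #|Z|%:R.

Lemma eq_avg F G : F =1 G -> avg F = avg G.
Proof. by move=> FG; rewrite /avg (eq_bigr _ (fun z _ => FG z)). Qed.

Lemma avgD F G : avg (fun z => F z + G z) = avg F + avg G.
Proof. by rewrite /avg big_split mulrDl. Qed.

Lemma avgZ c F : avg (fun z => c * F z) = c * avg F.
Proof. by rewrite /avg -mulr_sumr mulrA. Qed.

Lemma avg_sum (J : finType) (Q : pred J) (F : J -> Z -> R) :
  avg (fun z => \sum_(j | Q j) F j z) = \sum_(j | Q j) avg (F j).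
Proof. by rewrite /avg exchange_big -mulr_suml. Qed.

Lemma avg_ge0 F : (forall z, 0 <= F z) -> 0 <= avg F.
Proof. by move=> F0; rewrite /avg divr_ge0 ?sumr_ge0. Qed.

Lemma le_avg F G : (forall z, F z <= G z) -> avg F <= avg G.
Proof. by move=> FG; rewrite /avg ler_wpM2r ?invr_ge0// ler_sum. Qed.

Lemma avg_reindex (h : Z -> Z) F : bijective h -> avg (F \o h) = avg F.
Proof. by move=> hb; rewrite /avg [in RHS](reindex h)//; exact: onW_bij. Qed.

(** The average of [(F + t G) ^ 2] is nonnegative for every [t]. The choice [t = - c / b] minimises
    it; if [b = 0] it is affine in [t], so its slope vanishes. *)
Lemma avg_cauchy_schwarz F G :
  avg (fun z => F z * G z) ^+ 2 <= avg (fun z => F z ^+ 2) * avg (fun z => G z ^+ 2).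
Proof.
set a := avg (fun z => F z ^+ 2); set b := avg (fun z => G z ^+ 2).
set c := avg _.
have quad t : 0 <= a + 2 * t * c + t ^+ 2 * b.
  rewrite /a /b /c -!avgZ -!avgD; apply: avg_ge0 => z.
  by rewrite (_ : _ + _ = (F z + t * G z) ^+ 2) ?sqr_ge0//; ring.
have a0 : 0 <= a by apply: avg_ge0 => z; exact: sqr_ge0.
have b0 : 0 <= b by apply: avg_ge0 => z; exact: sqr_ge0.
have [b00|bN0] := eqVneq b 0.
  rewrite b00 mulr0; suff -> : c = 0 by rewrite expr0n.
  apply/eqP; apply: contraT => cN0.
  have := quad (- (a + 1) / (2 * c)); rewrite b00 mulr0 addr0.
  rewrite (_ : 2 * _ * c = - (a + 1)); last by field.
  by rewrite opprD addrA subrr add0r lerNr oppr0 ler10.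
have := quad (- c / b).
have -> : a + 2 * (- c / b) * c + (- c / b) ^+ 2 * b = (a * b - c ^+ 2) / b by field.
by rewrite pmulr_lge0 ?invr_gt0 ?subr_ge0// lt_def bN0.
Qed.

End average.

(** * Walsh expansion, Parseval and noise *)

Section walsh.
Context {R : realFieldType} {I Z : finType}.
(** The cube is abstract because it will be the grid, whose bits are indexed by a coordinate
    together with a binary place. *)
Variables (bit : Z -> I -> bool) (flip : I -> Z -> Z).
Hypothesis bit_inj : forall z w, bit z =1 bit w -> z = w.
Hypothesis bit_flip : forall i z j, bit (flip i z) j = bit z j (+) (i == j).
Hypothesis card_cube : #|Z| = (2 ^ #|I|)%N.

Definition chi (S : {set I}) (z : Z) : R := \prod_(i in S) (-1) ^+ bit z i.

Definition walsh (f : Z -> R) (S : {set I}) : R := avg (fun z => f z * chi S z).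

Lemma card_cubeN0 : #|Z|%:R != 0 :> R.
Proof. by rewrite pnatr_eq0 card_cube expn_eq0. Qed.

Lemma avg_cst (c : R) : avg (fun _ : Z => c) = c.
Proof.
rewrite /avg (_ : \sum_z c = c * #|Z|%:R) ?mulfK ?card_cubeN0//.
by rewrite sumr_const mulr_natr.
Qed.

Lemma flipK i : involutive (flip i).
Proof. by move=> z; apply: bit_inj => j; rewrite !bit_flip -addbA addbb addbF. Qed.

Lemma avg_flip i (F : Z -> R) : avg (fun z => F (flip i z)) = avg F.
Proof. by apply: (avg_reindex (h := flip i)); exact: (Bijective (flipK i) (flipK i)). Qed.

Lemma avg_flip_odd i (F : Z -> R) : (forall z, F (flip i z) = - F z) -> avg F = 0.
Proof.
move=> Fodd; have := avg_flip i F.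
rewrite (eq_avg (G := fun z => -1 * F z)) ?avgZ ?mulN1r => [E|z]; first by lra.
by rewrite Fodd mulN1r.
Qed.

Lemma chi0 z : chi set0 z = 1.
Proof. by rewrite /chi big_set0. Qed.

Lemma chiU1 i (S : {set I}) z : i \notin S -> chi (i |: S) z = (-1) ^+ bit z i * chi S z.
Proof. by move=> iS; rewrite /chi big_setU1. Qed.

Lemma chi_flip i (S : {set I}) z : chi S (flip i z) = (-1) ^+ (i \in S) * chi S z.
Proof.
rewrite /chi; case: (boolP (i \in S)) => iS; last first.
  rewrite mul1r; apply: eq_bigr => j jS; rewrite bit_flip.
  by case: eqP => [ij|]; [rewrite ij jS in iS|rewrite addbF].
rewrite !(big_setD1 i iS)/= bit_flip eqxx signr_addb -mulrA mulrCA; congr (_ * (_ * _)).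
apply: eq_bigr => j; rewrite !inE => /andP[/negPf ji _].
by rewrite bit_flip eq_sym ji addbF.
Qed.

(** The sum over [S] factors over the coordinates, and a coordinate where [z] and [w] differ
    contributes a factor 0. *)
Lemma sum_chi z w : \sum_S chi S z * chi S w = (z == w)%:R * #|Z|%:R.
Proof.
have -> : \sum_S chi S z * chi S w
    = \prod_i ((-1) ^+ (bit z i (+) bit w i) + 1 : R).
  rewrite bigA_distr; apply: eq_bigr => S _.
  rewrite /chi -big_split/= big_mkcond/=; apply: eq_bigr => i _.
  by rewrite signr_addb.
have [<-|zw] := eqVneq z w.
  under eq_bigr do rewrite addbb expr0.
  by rewrite prodr_const mul1r card_cube natrX.
have [i] : exists i, bit z i != bit w i.
  apply/existsP; apply: contraNT zw => /existsPn H.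
  by apply/eqP/bit_inj => i; apply/eqP; rewrite -[_ == _]negbK H.
by move=> zwi; rewrite mul0r (bigD1 i)//= -negb_eqb zwi expr1 addNr mul0r.
Qed.

(** Expanding the squares gives a double sum over points, which [sum_chi] collapses to the
    diagonal. *)
Lemma parseval f : \sum_S walsh f S ^+ 2 = avg (fun z => f z ^+ 2).
Proof.
have N0 := card_cubeN0.
have -> : \sum_S walsh f S ^+ 2 =
   \sum_z \sum_w f z * f w * (\sum_S chi S z * chi S w) / #|Z|%:R ^+ 2.
  rewrite [RHS](_ : _ = \sum_z \sum_w \sum_S
     (f z * chi S z) * (f w * chi S w) / #|Z|%:R ^+ 2); last first.
    apply: eq_bigr => z _; apply: eq_bigr => w _.
    rewrite mulr_sumr mulr_suml; apply: eq_bigr => S _; congr (_ / _).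
    by ring.
  under [RHS]eq_bigr do rewrite exchange_big/=.
  rewrite [RHS]exchange_big/=; apply: eq_bigr => S _.
  rewrite /walsh /avg expr_div_n.
  under [RHS]eq_bigr do rewrite -mulr_suml -mulr_sumr.
  by rewrite -!mulr_suml -expr2.
rewrite /avg mulr_suml; apply: eq_bigr => z _.
rewrite (bigD1 z)//= sum_chi eqxx mul1r big1 ?addr0 => [|w /negPf wz].
  by field.
by rewrite sum_chi eq_sym wz !mul0r mulr0 mul0r.
Qed.

Lemma avg_sum_chi f (c : {set I} -> R) (J : pred {set I}) :
  avg (fun z => f z * \sum_(S | J S) c S * chi S z) = \sum_(S | J S) c S * walsh f S.
Proof.
rewrite (eq_avg (G := fun z => \sum_(S | J S) c S * (f z * chi S z))); last first.
  by move=> z; rewrite mulr_sumr; apply: eq_bigr => S _; ring.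
by rewrite avg_sum; apply: eq_bigr => S _; rewrite avgZ.
Qed.

(* The noise operator with parameter 1/3, on the polynomial with coefficients
   [a] restricted to the subsets of [J]. *)
Definition noise (J : {set I}) (a : {set I} -> R) (z : Z) : R :=
  \sum_(S : {set I} | S \subset J) 3^-1 ^+ #|S| * a S * chi S z.

Definition noise_form (J : {set I}) (a : {set I} -> R) : R :=
  \sum_(S : {set I} | S \subset J) 3^-1 ^+ #|S| * a S ^+ 2.

Lemma noise_form_ge0 J a : 0 <= noise_form J a.
Proof. by apply: sumr_ge0 => S _; rewrite mulr_ge0 ?sqr_ge0// exprn_ge0// invr_ge0. Qed.

Lemma big_subsetsU1 i (J : {set I}) (F : {set I} -> R) : i \notin J ->
  \sum_(S : {set I} | S \subset i |: J) F S =
  \sum_(S : {set I} | S \subset J) F S + \sum_(S : {set I} | S \subset J) F (i |: S).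
Proof.
move=> iJ; rewrite (bigID (fun S : {set I} => i \notin S))/=; congr (_ + _).
  apply: eq_bigl => S; apply/andP/idP => [[SJ iS]|SJ].
    by rewrite -(setU1K iJ) subsetD1 SJ iS.
  by split; [exact: subset_trans SJ (subsetUr _ _)|apply: contra iJ => /(subsetP SJ)].
rewrite (reindex_onto (fun S => i |: S) (fun S => S :\ i)); last first.
  by move=> S /andP[_]; rewrite negbK => iS; rewrite setD1K.
apply: eq_bigl => S; rewrite negbK setU11 andbT.
apply/andP/idP => [[sS /eqP E]|SJ].
  have iS : i \notin S by rewrite -E !inE eqxx.
  by rewrite -(setU1K iJ) -(setU1K iS) setSD.
have iS : i \notin S by apply: contra iJ => /(subsetP SJ).
by rewrite setU1K ?eqxx ?setUS.
Qed.

Lemma noiseU1 i (J : {set I}) a z : i \notin J ->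
  noise (i |: J) a z =
  noise J a z + (-1) ^+ bit z i * (3^-1 * noise J (fun S => a (i |: S)) z).
Proof.
move=> iJ; rewrite /noise big_subsetsU1//; congr (_ + _).
rewrite !mulr_sumr; apply: eq_bigr => S SJ.
have iS : i \notin S by apply: contra iJ => /(subsetP SJ).
by rewrite cardsU1 iS chiU1// exprS; ring.
Qed.

Lemma noise_formU1 i (J : {set I}) a : i \notin J ->
  noise_form (i |: J) a =
  noise_form J a + 3^-1 * noise_form J (fun S => a (i |: S)).
Proof.
move=> iJ; rewrite /noise_form big_subsetsU1//; congr (_ + _).
rewrite mulr_sumr; apply: eq_bigr => S SJ.
have iS : i \notin S by apply: contra iJ => /(subsetP SJ).
by rewrite cardsU1 iS exprD expr1; ring.
Qed.

Lemma noise_flip i (J : {set I}) a z : i \notin J -> noise J a (flip i z) = noise J a z.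
Proof.
move=> iJ; apply: eq_bigr => S SJ; rewrite chi_flip (_ : i \in S = false) ?mul1r//.
by apply: contraNF iJ => /(subsetP SJ).
Qed.


(** The terms odd in the sign [(-1) ^+ bit z i] change sign under [flip i] and average to 0. *)
Lemma avg_fourth_split i (p q : Z -> R) :
  (forall z, p (flip i z) = p z) -> (forall z, q (flip i z) = q z) ->
  avg (fun z => (p z + (-1) ^+ bit z i * q z) ^+ 4) =
  avg (fun z => p z ^+ 4) + 6 * avg (fun z => p z ^+ 2 * q z ^+ 2) +
  avg (fun z => q z ^+ 4).
Proof.
move=> pi qi.
pose odd z := (-1) ^+ bit z i * (4 * p z ^+ 3 * q z + 4 * p z * q z ^+ 3) : R.
rewrite (eq_avg (G := fun z => p z ^+ 4 + 6 * (p z ^+ 2 * q z ^+ 2) + q z ^+ 4 + odd z)).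
  rewrite avgD (@avg_flip_odd i odd) ?addr0 ?avgD ?avgZ// => z.
  by rewrite /odd pi qi bit_flip eqxx signr_addb expr1 mulrN1 mulNr.
by move=> z; rewrite /odd; case: (bit z i); rewrite ?expr1 ?expr0; ring.
Qed.

(* Bonami's lemma: in terms of [noise_form], the squared L2 norm after
   noise [1 / sqrt 3], no square roots are needed. *)
Lemma hypercontractive J a : avg (fun z => noise J a z ^+ 4) <= noise_form J a ^+ 2.
Proof.
have [n] := ubnP #|J|; elim: n J a => // n IH J a; rewrite ltnS => Jn.
have [->|[i iJ]] := set_0Vmem J.
  have E F : \sum_(S : {set I} | S \subset set0) F S = F set0 :> R.
    by under eq_bigl do rewrite subset0; rewrite big_pred1_eq.
  rewrite /noise_form E /noise.
  rewrite (eq_avg (G := fun _ => a set0 ^+ 4)) ?avg_cst => [|z].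
    by rewrite cards0 expr0 mul1r -exprM.
  by rewrite E cards0 expr0 chi0 mul1r mulr1.
set J' := J :\ i; have iJ' : i \notin J' by rewrite !inE eqxx.
have J'n : (#|J'| < n)%N by move: Jn; rewrite (cardsD1 i J) iJ.
rewrite -(setD1K iJ) -/J' noise_formU1//.
set b := fun S => a (i |: S).
under eq_avg do rewrite noiseU1//.
rewrite (@avg_fourth_split i (noise J' a) (fun z => 3^-1 * noise J' b z)); first last.
- by move=> z; rewrite noise_flip.
- by move=> z; rewrite noise_flip.
have Ha := IH _ a J'n; have Hb := IH _ b J'n.
have Wa := noise_form_ge0 J' a; have Wb := noise_form_ge0 J' b.
rewrite (eq_avg (F := fun z => _ * _ ^+ 2)
  (G := fun z => 9^-1 * (noise J' a z ^+ 2 * noise J' b z ^+ 2))); last first.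
  by move=> z; field.
rewrite (eq_avg (F := fun z => (3^-1 * _) ^+ 4)
  (G := fun z => 81^-1 * noise J' b z ^+ 4)); last first.
  by move=> z; field.
rewrite !avgZ; move: Ha Hb Wa Wb.
have := avg_cauchy_schwarz (fun z => noise J' a z ^+ 2) (fun z => noise J' b z ^+ 2).
under [X in _ <= X * _]eq_avg do rewrite -exprM.
under [X in _ <= _ * X]eq_avg do rewrite -exprM.
have : 0 <= avg (fun z => noise J' b z ^+ 4).
  by apply: avg_ge0 => z; rewrite (exprM _ 2 2) sqr_ge0.
have : 0 <= avg (fun z => noise J' a z ^+ 4).
  by apply: avg_ge0 => z; rewrite (exprM _ 2 2) sqr_ge0.
move: (avg (fun z => noise J' a z ^+ 4)) (avg (fun z => noise J' b z ^+ 4))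
  (avg (fun z => noise J' a z ^+ 2 * _)).
move: (noise_form J' a) (noise_form J' b) => A B x y t x0 y0 txy xA yB A0 B0.
have tAB : t <= A * B.
  rewrite -[A * B]ger0_norm ?mulr_ge0//; apply: le_trans (ler_norm _) _.
  rewrite -ler_sqr ?nnegrE// !real_normK ?num_real// exprMn.
  by apply: le_trans txy _; exact: ler_pM.
(* The cross term [6 / 9 * t] is at most [2 / 3 * A * B], exactly the cross term of
   [(A + B / 3) ^ 2]: this is where the noise parameter 1/3 comes from. *)
nra.
Qed.

(** * Influences of bits and the variance *)

Section discrete_derivative.
Variables (f : Z -> R).
Hypothesis f01 : forall z, f z = 0 \/ f z = 1.

Let D i z := f z - f (flip i z).

Definition bit_influence i : R := avg (fun z => (f z != f (flip i z))%:R).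

Lemma D_sq i z : D i z ^+ 2 = (f z != f (flip i z))%:R.
Proof.
rewrite /D; case: (f01 z) (f01 (flip i z)) => [->|->] [->|->];
  rewrite ?eqxx ?oner_eq0 1?eq_sym ?oner_eq0/=; ring.
Qed.

Lemma walshD i S : walsh (D i) S = (i \in S)%:R * 2 * walsh f S.
Proof.
rewrite /walsh (eq_avg (G := fun z => f z * chi S z + (-1) * (f (flip i z) * chi S z))).
  rewrite avgD avgZ -(avg_flip i (fun z => f (flip i z) * chi S z)).
  under [X in _ + _ * X]eq_avg do rewrite flipK chi_flip mulrCA.
  by rewrite avgZ; case: (i \in S); rewrite ?expr1 ?expr0/=; ring.
by move=> z; rewrite /D; ring.
Qed.

Lemma bit_influenceE i : bit_influence i = \sum_(S : {set I} | i \in S) 4 * walsh f S ^+ 2.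
Proof.
rewrite /bit_influence -(eq_avg (D_sq i)) -parseval big_mkcond [RHS]big_mkcond/=.
by apply: eq_bigr => S _; rewrite walshD; case: ifP => iS/=; rewrite ?iS/=; ring.
Qed.

(** The value of [noise_form] on the Walsh coefficients of [D i]: the squared L2 norm of the
    derivative after noise [1 / sqrt 3]. *)
Definition noisy_influence i : R :=
  \sum_(S : {set I} | i \in S) 4 * 3^-1 ^+ #|S| * walsh f S ^+ 2.

Lemma bit_influence_ge0 i : 0 <= bit_influence i.
Proof. by apply: avg_ge0 => z; exact: ler0n. Qed.

Lemma noisy_influence_ge0 i : 0 <= noisy_influence i.
Proof.
by apply: sumr_ge0 => S _; rewrite mulr_ge0 ?sqr_ge0// mulr_ge0// exprn_ge0// invr_ge0.
Qed.

(** Hypercontractivity improves the trivial bound [s <= q] to the power 3/2 of [q]: two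
    Cauchy-Schwarz steps give [s ^ 4 <= q ^ 3 * s ^ 2]. *)
Lemma noisy_influence_sq i : noisy_influence i ^+ 2 <= bit_influence i ^+ 3.
Proof.
set s := noisy_influence i; set q := bit_influence i.
pose u := noise setT (walsh (D i)).
have sW : s = noise_form setT (walsh (D i)).
  rewrite /s /noisy_influence big_mkcond [RHS]big_mkcond/=; apply: eq_bigr => S _.
  by rewrite walshD subsetT; case: (i \in S) => /=; ring.
have sE : s = avg (fun z => D i z * u z).
  rewrite avg_sum_chi sW; apply: eq_bigr => S _; ring.
have s0 : 0 <= s := noisy_influence_ge0 i.
have q0 : 0 <= q := bit_influence_ge0 i.
have qE : q = avg (fun z => D i z ^+ 2) by rewrite (eq_avg (D_sq i)).
have q4 : q = avg (fun z => (D i z ^+ 2) ^+ 2).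
  rewrite (eq_avg (G := fun z => D i z ^+ 2)) ?qE// => z.
  by rewrite D_sq; case: eqP; rewrite ?expr1n ?expr0n.
(* Cauchy-Schwarz twice, using [D = D * D ^ 2] *)
have cs1 : s ^+ 2 <= q * avg (fun z => D i z ^+ 2 * u z ^+ 2).
  rewrite qE sE (eq_avg (G := fun z => D i z * (D i z ^+ 2 * u z))).
    apply: le_trans (avg_cauchy_schwarz _ _) _.
    rewrite ler_wpM2l ?avg_ge0// => [z|]; first exact: sqr_ge0.
    rewrite le_eqVlt; apply/orP; left; apply/eqP; apply: eq_avg => z.
    by rewrite exprMn D_sq; case: eqP; rewrite ?expr1n ?expr0n.
  move=> z; rewrite mulrA -exprS; congr (_ * _).
  by rewrite exprS D_sq /D; case: eqP => [->|]; rewrite ?subrr ?mulr0 ?mulr1.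
have cs2 : avg (fun z => D i z ^+ 2 * u z ^+ 2) ^+ 2 <= q * s ^+ 2.
  apply: le_trans (avg_cauchy_schwarz _ _) _; rewrite -q4.
  rewrite ler_wpM2l// sW (eq_avg (G := fun z => u z ^+ 4)) ?hypercontractive// => z.
  by rewrite -exprM.
have [s00|sN0] := eqVneq s 0; first by rewrite s00 expr0n/= exprn_ge0.
have s2 : 0 < s ^+ 2 by rewrite exprn_gt0// lt_def sN0.
rewrite -(ler_pM2r s2).
have t0 : 0 <= avg (fun z => D i z ^+ 2 * u z ^+ 2).
  by apply: avg_ge0 => z; rewrite mulr_ge0 ?sqr_ge0.
apply: (@le_trans _ _ (q ^+ 2 * (avg (fun z => D i z ^+ 2 * u z ^+ 2)) ^+ 2)).
  by rewrite -[leRHS]exprMn -[leLHS]expr2 ler_sqr ?nnegrE//; [exact: sqr_ge0|exact: mulr_ge0].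
by rewrite [q ^+ 3]exprSr -[leRHS]mulrA; apply: ler_wpM2l => //; exact: exprn_ge0.
Qed.

(** AM-GM for [q ^ 3 = (lam * q) * (q ^ 2 / lam)] trades the power 3/2 for a quadratic polynomial in
    [q], so that averaging over samples later involves only first and second moments. *)
Lemma noisy_influence_le i (lam : R) : 0 < lam ->
  noisy_influence i <= lam * bit_influence i + bit_influence i ^+ 2 / lam.
Proof.
move=> lam0; have q0 := bit_influence_ge0 i; have := noisy_influence_sq i.
set s := noisy_influence i; set q := bit_influence i in q0 *.
have s0 : 0 <= s := noisy_influence_ge0 i.
have r0 : 0 <= q ^+ 2 / lam by rewrite divr_ge0 ?exprn_ge0// ltW.
have l0 : 0 <= lam * q by rewrite mulr_ge0// ltW.
have -> : q ^+ 3 = (lam * q) * (q ^+ 2 / lam) by field; exact: lt0r_neq0.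
move=> H; rewrite -ler_sqr ?nnegrE ?addr_ge0//; apply: le_trans H _; nra.
Qed.

(** The left side is the variance of [f], the sum of its squared coefficients over nonempty sets.
    Sets of size at least [d] are paid for by the influences, as [#|S| / d >= 1], smaller ones by
    the noisy influences, as [3 ^ (d - #|S|) >= 1]. *)
Lemma variance_bound d : (0 < d)%N ->
  avg f - avg f ^+ 2 <=
  (4 * d%:R)^-1 * (\sum_i bit_influence i) + 3 ^+ d / 4 * (\sum_i noisy_influence i).
Proof.
move=> d0.
have dR : 0 < d%:R :> R by rewrite ltr0n.
have -> : avg f - avg f ^+ 2 = \sum_(S : {set I} | S != set0) walsh f S ^+ 2.
  have /eqP := parseval f; rewrite (bigD1 set0)//= => /eqP.
  rewrite /walsh (eq_avg (F := fun z => f z * chi set0 z) (G := f)) => [|z]; last first.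
    by rewrite chi0 mulr1.
  rewrite [RHS](_ : _ = avg f) => [E|]; first by rewrite -[X in X - _]E [LHS]addrC addKr.
  by apply: eq_avg => z; case: (f01 z) => ->; rewrite ?expr1n ?expr0n.
have cnt (c : {set I} -> R) :
    \sum_i \sum_(S : {set I} | i \in S) c S = \sum_(S : {set I}) #|S|%:R * c S.
  rewrite (exchange_big_dep xpredT)//=; apply: eq_bigr => S _.
  by rewrite sumr_const mulr_natl.
rewrite (eq_bigr _ (fun i _ => bit_influenceE i)) /noisy_influence !cnt.
rewrite !mulr_sumr -big_split [leLHS]big_mkcond/=; apply: ler_sum => S _.
have w0 := sqr_ge0 (walsh f S); set w := walsh f S ^+ 2 in w0 *.
rewrite [leRHS](_ : _ = (#|S|%:R / d%:R + #|S|%:R * (3 ^+ d * 3^-1 ^+ #|S|)) * w); last first.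
  by field; exact: lt0r_neq0.
have dS0 : 0 <= #|S|%:R / d%:R :> R by exact: divr_ge0.
have eS0 : 0 <= #|S|%:R * (3 ^+ d * 3^-1 ^+ #|S|) :> R.
  by apply: mulr_ge0 => //; apply: mulr_ge0; rewrite exprn_ge0// invr_ge0.
case: ifP => [S0|_]; last by rewrite mulr_ge0 ?addr_ge0.
have S1 : (0 < #|S|)%N by rewrite card_gt0.
rewrite ler_peMl//; have [dS|Sd] := leqP d #|S|.
  by apply: le_trans (ler_wpDr eS0 (lexx _)); rewrite ler_pdivlMr// mul1r ler_nat.
apply: le_trans (ler_wpDl dS0 (lexx _)).
by rewrite exprVn -expfB// mulr_ege1 ?exprn_ege1 ?ler1n.
Qed.

End discrete_derivative.
End walsh.

(** * Compressions *)

Section update.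
Context {E L : finType}.
Implicit Types (z : {ffun E -> L}) (G : {set {ffun E -> L}}).

Definition update z e l : {ffun E -> L} := [ffun f => if f == e then l else z f].

Lemma update_same z e l : update z e l e = l.
Proof. by rewrite ffunE eqxx. Qed.

Lemma update_other z e l f : f != e -> update z e l f = z f.
Proof. by rewrite ffunE => /negPf ->. Qed.

Lemma update_id z e : update z e (z e) = z.
Proof. by apply/ffunP => f; rewrite ffunE; case: eqP => [->|]. Qed.

Lemma updateK z e l l' : update (update z e l) e l' = update z e l'.
Proof. by apply/ffunP => f; rewrite !ffunE; case: eqP. Qed.

Lemma updateC z e f l m : e != f ->
  update (update z e l) f m = update (update z f m) e l.
Proof.
move=> /negPf ef; apply/ffunP => g; rewrite !ffunE.
by case: (eqVneq g f) => [->|//]; rewrite eq_sym ef.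
Qed.

Definition sensitive G e z : bool := [exists l, (update z e l \in G) != (z \in G)].

Lemma insensitiveP G e z :
  reflect (forall l, (update z e l \in G) = (z \in G)) (~~ sensitive G e z).
Proof.
apply: (iffP existsPn) => H l; last by rewrite H eqxx.
by apply/eqP; have := H l; rewrite negbK.
Qed.

(** The map from [(z, l)] to [(update z e l, z e)] is an involution: resampling one coordinate
    preserves the counting measure. *)
Lemma sum_update (F : {ffun E -> L} -> nat) e :
  (\sum_z \sum_l F (update z e l) = #|L| * \sum_z F z)%N.
Proof.
pose h (p : {ffun E -> L} * L) := (update p.1 e p.2, p.1 e).
have hK : involutive h.
  by move=> [z l]; rewrite /h/= update_same updateK update_id.
rewrite pair_big/= (reindex_inj (inv_inj hK))/=.
transitivity (\sum_z \sum_(l : L) F z)%N.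
  by rewrite pair_big/=; apply: eq_bigr => -[z l] _ /=; rewrite updateK update_id.
by rewrite exchange_big/= sum_nat_const.
Qed.

End update.

Section compression.
Context {E L : finType} (v : L -> nat).
Hypothesis v_inj : injective v.
Implicit Types (z : {ffun E -> L}) (G : {set {ffun E -> L}}).

Section one_step.
Variables (e : E) (a b : L).
Hypothesis vab : (v a < v b)%N.

Definition swap z := update z e (tperm a b (z e)).

Lemma swapK : involutive swap.
Proof. by move=> z; rewrite /swap update_same updateK tpermK update_id. Qed.

Let ab : a != b.
Proof. by apply: contraTneq vab => ->; rewrite ltnn. Qed.

Let ba : b != a.
Proof. by rewrite eq_sym. Qed.

(** The classical shifting operator: when exactly one of two points differing only by the letters
    [a] and [b] at [e] lies in [G], the one with letter [b] is taken instead. *)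
Definition compress G : {set {ffun E -> L}} :=
  [set z : {ffun E -> L} | if z e == a then (z \in G) && (swap z \in G)
           else if z e == b then (z \in G) || (swap z \in G)
           else z \in G].

(** Case analysis on the pair [z], [swap z], giving both new memberships at once: the conjunction
    sits at letter [a], the disjunction at letter [b]. *)
Variant compress_spec G z : {ffun E -> L} -> bool -> bool -> Prop :=
  | CompressA of z e = a :
      compress_spec G z (update z e b)
        ((z \in G) && (update z e b \in G)) ((z \in G) || (update z e b \in G))
  | CompressB of z e = b :
      compress_spec G z (update z e a)
        ((z \in G) || (update z e a \in G)) ((z \in G) && (update z e a \in G))
  | CompressO of z e != a & z e != b :
      compress_spec G z z (z \in G) (z \in G).

Lemma compressP G z :
  compress_spec G z (swap z) (z \in compress G) (swap z \in compress G).
Proof.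
rewrite !inE swapK {2 4}/swap update_same.
case: tpermP => [ze|ze|/eqP za /eqP zb].
- rewrite ze (negPf ba) !eqxx /swap ze tpermL andbC [X in _ _ _ X]orbC andbC.
  by constructor.
- rewrite ze (negPf ba) !eqxx /swap ze tpermR orbC [X in _ _ _ X]andbC orbC.
  by constructor.
- rewrite (negPf za) (negPf zb) /swap tpermD 1?eq_sym// update_id.
  by constructor.
Qed.

Lemma sum_swap (F : {ffun E -> L} -> nat) :
  (\sum_z (F z + F (swap z)) = 2 * \sum_z F z)%N.
Proof.
rewrite big_split/= mul2n -addnn; congr (_ + _)%N.
by rewrite [RHS](reindex_inj (inv_inj swapK)).
Qed.

(** Adding [F z + F (swap z)] over all [z] counts every term twice, so a comparison pair by pair
    suffices. *)
Lemma le_sum_swap (F F' : {ffun E -> L} -> nat) :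
  (forall z, F z + F (swap z) <= F' z + F' (swap z))%N ->
  (\sum_z F z <= \sum_z F' z)%N.
Proof.
move=> FF'; rewrite -(leq_pmul2l (isT : 0 < 2)%N) -!sum_swap.
exact: leq_sum.
Qed.

Lemma card_sum G : #|G| = (\sum_z (z \in G))%N.
Proof. by rewrite -sum1_card big_mkcond/=; apply: eq_bigr => z _; case: (z \in G). Qed.

Lemma card_compress G : #|compress G| = #|G|.
Proof.
rewrite !card_sum; apply/eqP; rewrite eqn_leq; apply/andP; split;
  apply: le_sum_swap => z; case: compressP => _ //;
  by case: (z \in G); case: (_ \in G).
Qed.

Lemma swap_update z f l : f != e -> swap (update z f l) = update (swap z) f l.
Proof. by move=> fe; rewrite /swap update_other 1?eq_sym// updateC. Qed.

(** [swap] preserves each fibre in direction [e], and the compression leaves alone a fibre wholly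
    inside or wholly outside [G]. *)
Lemma sensitive_compress_same G z : sensitive (compress G) e z -> sensitive G e z.
Proof.
apply: contraTT => /insensitiveP H; apply/insensitiveP => l.
have H' m : (swap (update z e m) \in G) = (z \in G) by rewrite /swap updateK H.
by rewrite !inE !H' !H andbb orbb !if_same.
Qed.

(** When [swap] moves [z], the traces of [G] on the parallel fibres through [z] and [swap z] are
    replaced by their intersection and their union. If one trace is constant, so is the intersection
    or the union; if both are, so are both. *)
Lemma sensitive_compress_other G f z : f != e ->
  (sensitive (compress G) f z + sensitive (compress G) f (swap z)
   <= sensitive G f z + sensitive G f (swap z))%N.
Proof.
move=> fe.
have sens0 z' : ~~ sensitive G f z' -> ~~ sensitive G f (swap z') ->
    ~~ sensitive (compress G) f z'.
  move=> /insensitiveP H /insensitiveP H'; apply/insensitiveP => l.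
  by rewrite !inE (swap_update _ _ fe) !H !H' update_other// eq_sym.
have sens1 z' : ~~ sensitive G f z' -> sensitive (compress G) f z' ->
    ~~ sensitive (compress G) f (swap z').
  move=> /insensitiveP H /existsP[m Sm]; apply/insensitiveP => l; move: Sm.
  rewrite !inE !(swap_update _ _ fe) !swapK.
  have upd w n : update w f n e = w e by rewrite update_other// eq_sym.
  rewrite !upd !H.
  rewrite /swap update_same; case: tpermP => [ze|ze|/eqP za /eqP zb].
  - by rewrite ze (negPf ba) !eqxx; case: (z' \in G); rewrite ?orbT.
  - by rewrite ze (negPf ba) !eqxx; case: (z' \in G); rewrite ?andbF.
  - by rewrite (negPf za) (negPf zb) eqxx.
case: (boolP (sensitive G f z)) => nG; case: (boolP (sensitive G f (swap z))) => nG'.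
- exact: leq_add (leq_b1 _) (leq_b1 _).
- have := sens1 _ nG'; rewrite swapK.
  case: (sensitive (compress G) f (swap z)) => [/(_ isT)/negPf -> //|_].
  by rewrite addn0 leq_b1.
- have := sens1 _ nG.
  case: (sensitive (compress G) f z) => [/(_ isT)/negPf -> //|_].
  by rewrite add0n leq_b1.
- by rewrite (negPf (sens0 _ nG nG')) (negPf (sens0 _ nG' _)) ?swapK.
Qed.

Definition potential G : nat := (\sum_z (z \in G) * \sum_f v (z f))%N.

Lemma weight_update z l :
  (v (z e) + \sum_f v (update z e l f) = v l + \sum_f v (z f))%N.
Proof.
rewrite (bigD1 e)//= (bigD1 e (P := xpredT))//= update_same.
rewrite (eq_bigr (fun f => v (z f))) => [|f fe]; first by rewrite addnCA.
by rewrite update_other.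
Qed.

(** No pair loses weight, since points move only from [a] to the heavier letter [b]; the pair of [z]
    gains strictly. *)
Lemma potential_compress G z : z e = a -> z \in G -> update z e b \notin G ->
  (potential G < potential (compress G))%N.
Proof.
move=> ze zG zbG.
pose F G' w := ((w \in G') * \sum_f v (w f))%N.
have le w : (F G w + F G (swap w) <= F (compress G) w + F (compress G) (swap w))%N.
  rewrite /F; case: compressP => [we|we|_ _ //].
    by have := weight_update w b; rewrite we; case: (w \in G); case: (_ \in G) => /=; lia.
  by have := weight_update w a; rewrite we; case: (w \in G); case: (_ \in G) => /=; lia.
rewrite -(ltn_pmul2l (isT : 0 < 2)%N) /potential -!sum_swap.
rewrite (bigD1 z)//= [ltnRHS](bigD1 z)//= -addSn leq_add//; last first.
  by apply: leq_sum => w _; exact: le.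
case: compressP => [_|zb|]; last by rewrite ze eqxx.
  rewrite (negPf zbG) zG /=; have := weight_update z b; rewrite ze; lia.
by move: ab; rewrite -ze zb eqxx.
Qed.

End one_step.

(* A set of largest potential among those with the same size and no larger
   influences is fixed by all compressions, hence monotone. *)
Lemma monotone_rearrangement G : exists G' : {set {ffun E -> L}},
  [/\ #|G'| = #|G|,
      forall e, (\sum_z sensitive G' e z <= \sum_z sensitive G e z)%N &
      forall z e l, (v (z e) <= v l)%N -> z \in G' -> update z e l \in G'].
Proof.
pose good G' := (#|G'| == #|G|) &&
  [forall e, (\sum_z sensitive G' e z <= \sum_z sensitive G e z)%N].
have goodG : good G by rewrite /good eqxx; apply/forallP => e.
case: (arg_maxnP potential goodG) => G' /andP[/eqP cardG' /forallP inflG'] maxG'.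
exists G'; split=> // z e l vl zG'.
apply/negPn/negP => nG'; have vlt : (v (z e) < v l)%N.
  rewrite ltn_neqAle vl andbT; apply: contra nG' => /eqP/v_inj <-.
  by rewrite update_id.
have := potential_compress vlt erefl zG' nG'; apply/negP; rewrite -leqNgt.
apply: maxG'; rewrite /good card_compress// cardG' eqxx; apply/forallP => f.
apply: leq_trans (inflG' f); have [->|fe] := eqVneq f e.
  apply: leq_sum => w _; have := @sensitive_compress_same e (z e) l G' w.
  by case: (sensitive (compress _ _ _ _) e w) => // ->.
apply: (le_sum_swap (e := e) (a := z e) (b := l)) => w.
exact: sensitive_compress_other.
Qed.

End compression.

(** * Binary letters and thresholds *)

Section binary_letters.
Variable k : nat.
Implicit Types l : {ffun 'I_k -> bool}.

Definition binval l : nat := (\sum_(b < k) l b * 2 ^ b)%N.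

Lemma binary_lt n (c : 'I_n -> bool) : (\sum_(b < n) c b * 2 ^ b < 2 ^ n)%N.
Proof.
elim: n c => [|n IH] c; first by rewrite big_ord0.
rewrite big_ord_recr/= expnS mul2n -addnn.
rewrite -addSn leq_add ?(IH (fun b => c (widen_ord (leqnSn n) b)))//.
by case: (c _); rewrite ?mul1n.
Qed.

Lemma binary_inj n (c c' : 'I_n -> bool) :
  (\sum_(b < n) c b * 2 ^ b = \sum_(b < n) c' b * 2 ^ b)%N -> c =1 c'.
Proof.
elim: n c c' => [|n IH] c c' + b; first by case: b.
rewrite !big_ord_recr/=.
have := binary_lt (fun b => c (widen_ord (leqnSn n) b)).
have := binary_lt (fun b => c' (widen_ord (leqnSn n) b)).
have := @IH (fun b => c (widen_ord (leqnSn n) b)) (fun b => c' (widen_ord (leqnSn n) b)).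
move: (\sum_(b < n) _)%N (\sum_(b < n) _)%N => x y IHxy y2 x2 xy.
have cc : c ord_max = c' ord_max.
  by case: (c ord_max) (c' ord_max) xy => -[] //; rewrite ?mul1n ?mul0n; lia.
have [[j ->]|->//] : (exists j : 'I_n, b = widen_ord (leqnSn n) j) \/ b = ord_max.
  have [bn|] := ltnP b n; first by left; exists (Ordinal bn); exact: val_inj.
  by move=> nb; right; apply: val_inj => /=; apply/eqP; rewrite eqn_leq nb -ltnS ltn_ord.
by apply: IHxy; move: xy; rewrite cc => /addIn.
Qed.

Lemma binval_inj : injective binval.
Proof. by move=> l l' /binary_inj H; apply/ffunP. Qed.

Definition flip_letter b l : {ffun 'I_k -> bool} := [ffun c => l c (+) (b == c)].

Lemma flip_letterK b : involutive (flip_letter b).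
Proof. by move=> l; apply/ffunP => c; rewrite !ffunE -addbA addbb addbF. Qed.

Lemma binval_flip b l : ~~ l b -> binval (flip_letter b l) = (binval l + 2 ^ b)%N.
Proof.
move=> lb; rewrite /binval (bigD1 b)//= [in RHS](bigD1 b)//= (negPf lb) ffunE (negPf lb).
rewrite eqxx mul1n mul0n add0n addnC; congr (_ + _)%N; apply: eq_bigr => c /negPf cb.
by rewrite ffunE eq_sym cb addbF.
Qed.

(* In a final segment, bit [b] is decisive only within distance [2 ^ b] of
   the threshold. *)
Lemma threshold_flip (h : {ffun 'I_k -> bool} -> bool) b :
  (forall l l', (binval l <= binval l')%N -> h l -> h l') ->
  (\sum_l (h l != h (flip_letter b l)) <= 2 * 2 ^ b)%N.
Proof.
move=> hmon.
pose D := [set l : {ffun 'I_k -> bool} | ~~ l b && (h l != h (flip_letter b l))].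
have D2 : (\sum_l (h l != h (flip_letter b l)) = 2 * #|D|)%N.
  rewrite (bigID (fun l => l b))/= mul2n -addnn; congr (_ + _)%N.
    rewrite (reindex_inj (inv_inj (flip_letterK b)))/= -sum1_card big_mkcond [RHS]big_mkcond/=.
    apply: eq_bigr => l _; rewrite flip_letterK inE ffunE eqxx addbT.
    by case: (l b); case: (h l); case: (h _).
  rewrite -sum1_card big_mkcond [RHS]big_mkcond/=; apply: eq_bigr => l _.
  by rewrite inE; case: (l b); case: (h l != _).
have Dh l : l \in D -> ~~ h l && h (flip_letter b l).
  rewrite inE => /andP[lb]; have := hmon l (flip_letter b l).
  by rewrite binval_flip// leq_addr; case: (h l) => [->|]//=; case: (h _).
have close l l' : l \in D -> l' \in D -> (binval l < binval l' + 2 ^ b)%N.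
  move=> lD l'D; rewrite ltnNge; apply/negP => H.
  have /andP[nhl _] := Dh _ lD; have /andP[_ hl'] := Dh _ l'D.
  move: nhl; rewrite (hmon (flip_letter b l') l)// binval_flip//.
  by move: l'D; rewrite inE => /andP[].
rewrite D2 leq_mul2l/=; have [->|[l0 l0D]] := set_0Vmem D; first by rewrite cards0.
case: (arg_minnP binval l0D) => m mD mmin.
rewrite -[leqRHS]card_ord.
(* By [close], the values on [D] lie within [2 ^ b] of their minimum, so subtracting it injects [D]
   into ['I_(2 ^ b)]; the default of [insubd] is not reached on [D]. *)
pose g l : 'I_(2 ^ b) := insubd (Ordinal (expn_gt0 2 b)) (binval l - binval m)%N.
have gE l : l \in D -> val (g l) = (binval l - binval m)%N.
  move=> lD; rewrite val_insubd ifT// ltn_subLR ?mmin//.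
  exact: close.
rewrite -(card_in_imset (f := g)); first exact: max_card.
move=> l l' lD l'D /(congr1 val); rewrite !gE// => H; apply: binval_inj.
by have := mmin _ lD; have := mmin _ l'D; lia.
Qed.

End binary_letters.

(** * The inequality on the finite grid *)

Section discrete_kkl.
Variables (R : realFieldType) (E : finType) (k : nat).
Local Notation L := {ffun 'I_k -> bool}.
Local Notation Z := {ffun E -> {ffun 'I_k -> bool}}.
Implicit Types (z : Z) (G : {set Z}).

Let bit z (i : E * 'I_k) := z i.1 i.2.
Let flip (i : E * 'I_k) z : Z := update z i.1 (flip_letter i.2 (z i.1)).

Let bit_inj z w : bit z =1 bit w -> z = w.
Proof. by move=> H; apply/ffunP => e; apply/ffunP => b; exact: (H (e, b)). Qed.

Let bit_flip i z j : bit (flip i z) j = bit z j (+) (i == j).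
Proof.
case: i j => [e b] [f c]; rewrite /bit /flip/= xpair_eqE.
have [->|ef] := eqVneq e f; first by rewrite update_same ffunE.
by rewrite update_other 1?eq_sym// addbF.
Qed.

Let card_Z : #|{: Z}| = (2 ^ #|{: E * 'I_k}|)%N.
Proof. by rewrite !card_ffun card_prod card_bool card_ord -expnM mulnC. Qed.

Definition discrete_influence G e : R := avg (fun z => (sensitive G e z)%:R).

Lemma discrete_influence_ge0 G e : 0 <= discrete_influence G e.
Proof. by apply: avg_ge0 => z; exact: ler0n. Qed.

(** [sum_update] averages the flip over each fibre in direction [e]. Constant fibres contribute
    nothing; the others are final segments by monotonicity, and [threshold_flip] applies. *)
Lemma bit_influence_le G e b :
  (forall z e l, (binval (z e) <= binval l)%N -> z \in G -> update z e l \in G) ->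
  bit_influence flip (fun z => (z \in G)%:R) (e, b)
  <= 2 * 2 ^+ b / 2 ^+ k * discrete_influence G e.
Proof.
move=> monoG.
pose B z := (z \in G) != (flip (e, b) z \in G).
have key : (2 ^ k * \sum_z B z <= 2 * 2 ^ b * \sum_z sensitive G e z)%N.
  have -> : (2 ^ k = #|{: L}|)%N by rewrite card_ffun card_bool card_ord.
  rewrite -(sum_update _ e) big_distrr/=; apply: leq_sum => z _.
  have [_|/insensitiveP H] := boolP (sensitive G e z).
    rewrite muln1; pose h l := update z e l \in G.
    apply: leq_trans (@threshold_flip k h b _) => [|l l' ll' hl].
      by apply: leq_sum => l _; rewrite /B /h /flip/= update_same updateK.
    by rewrite /h -(updateK z e l l'); apply: monoG; rewrite ?update_same.
  rewrite muln0 leqn0; apply/eqP; apply: big1 => l _.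
  by rewrite /B /flip/= updateK !H eqxx.
rewrite /bit_influence /discrete_influence /avg.
have pB : (\sum_z ((z \in G)%:R != (flip (e, b) z \in G)%:R :> R)%:R) = (\sum_z B z)%:R :> R.
  rewrite natr_sum; apply: eq_bigr => z _; congr (nat_of_bool _)%:R.
  by rewrite /B; case: (z \in G); case: (_ \in G); rewrite ?eqxx ?oner_eq0// eq_sym oner_eq0.
rewrite pB -natr_sum mulrA ler_wpM2r ?invr_ge0//.
rewrite mulrAC ler_pdivlMr ?exprn_gt0// -!natrX -!natrM ler_nat.
by rewrite mulnC.
Qed.

(** [variance_bound] is applied to the monotone rearrangement. Over the bits of one coordinate the
    geometric bounds sum to twice its influence, and each bit influence is at most that influence,
    so the linear and the quadratic sums both lose only a factor 2. *)
Theorem discrete_kkl G d (lam : R) : (0 < d)%N -> 0 < lam ->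
  #|G|%:R / #|{: Z}|%:R - (#|G|%:R / #|{: Z}|%:R) ^+ 2 <=
  (2 * d%:R)^-1 * (\sum_e discrete_influence G e) +
  3 ^+ d / 2 * \sum_e (lam * discrete_influence G e + discrete_influence G e ^+ 2 / lam).
Proof.
move=> d0 lam0.
have [G' [cardG' inflG' monoG']] := monotone_rearrangement (@binval_inj k) G.
have leI e : discrete_influence G' e <= discrete_influence G e.
  by rewrite /discrete_influence /avg -!natr_sum ler_wpM2r ?invr_ge0// ler_nat.
pose f z : R := (z \in G')%:R.
have f01 z : f z = 0 \/ f z = 1 by rewrite /f; case: (z \in G'); [right|left].
have avgf : avg f = #|G|%:R / #|{: Z}|%:R.
  by rewrite /avg -natr_sum -card_sum cardG'.
rewrite -avgf.
apply: le_trans (variance_bound bit_inj bit_flip card_Z f01 d0) _.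
set q := bit_influence flip f.
have q0 i : 0 <= q i := bit_influence_ge0 _ _ _.
pose I' := discrete_influence G'.
have I0 e : 0 <= I' e := discrete_influence_ge0 _ _.
have qI e b : q (e, b) <= I' e.
  apply: le_avg => z; rewrite ler_nat; case: eqP => //= H; rewrite lt0b.
  apply/existsP; exists (flip_letter b (z e)).
  by apply/eqP => H'; apply: H; rewrite /f -H'.
have sum_q e : \sum_b q (e, b) <= 2 * I' e.
  apply: (@le_trans _ _ (\sum_(b < k) 2 * 2 ^+ b / 2 ^+ k * I' e)).
    by apply: ler_sum => b _; exact: bit_influence_le.
  rewrite -mulr_suml ler_wpM2r// -mulr_suml ler_pdivrMr ?exprn_gt0//.
  rewrite -mulr_sumr ler_wpM2l//.
  have : (\sum_(b < k) 2 ^ b <= 2 ^ k)%N.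
    have := binary_lt (fun _ : 'I_k => true).
    by under eq_bigr do rewrite mul1n; move/ltnW.
  by rewrite -(ler_nat R) natr_sum natrX; under eq_bigr do rewrite natrX.
have sum_q2 e : \sum_b q (e, b) ^+ 2 <= 2 * I' e ^+ 2.
  apply: (@le_trans _ _ (\sum_b I' e * q (e, b))).
    by apply: ler_sum => b _; rewrite expr2 ler_wpM2r.
  by rewrite -mulr_sumr [leRHS]mulrCA ler_wpM2l.
have sumE (F : E * 'I_k -> R) : \sum_i F i = \sum_e \sum_b F (e, b).
  by rewrite pair_big; apply: eq_bigr => -[].
rewrite lerD//.
  apply: (@le_trans _ _ ((4 * d%:R)^-1 * (\sum_e 2 * discrete_influence G e))).
    rewrite ler_wpM2l ?invr_ge0 ?mulr_ge0// sumE; apply: ler_sum => e _.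
    by apply: le_trans (sum_q e) _; rewrite ler_wpM2l// leI.
  by rewrite -mulr_sumr le_eqVlt; apply/orP; left; apply/eqP; field; rewrite pnatr_eq0 -lt0n.
apply: (@le_trans _ _ (3 ^+ d / 4 *
    (\sum_e 2 * (lam * discrete_influence G e + discrete_influence G e ^+ 2 / lam)))); last first.
  by rewrite -mulr_sumr mulrA le_eqVlt; apply/orP; left; apply/eqP; field.
rewrite ler_wpM2l ?divr_ge0 ?exprn_ge0// sumE; apply: ler_sum => e _.
apply: (@le_trans _ _ (\sum_b (lam * q (e, b) + q (e, b) ^+ 2 / lam))).
  by apply: ler_sum => b _; exact: noisy_influence_le.
rewrite big_split/= -mulr_sumr -[X in _ + X <= _]mulr_suml mulrDr lerD//.
  rewrite [leRHS]mulrCA ler_wpM2l ?(ltW lam0)//; apply: le_trans (sum_q e) _.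
  by rewrite ler_wpM2l// leI.
rewrite [leRHS]mulrA ler_wpM2r ?invr_ge0 ?(ltW lam0)//; apply: le_trans (sum_q2 e) _.
by rewrite ler_wpM2l// ler_sqr ?nnegrE// ?leI// discrete_influence_ge0.
Qed.

End discrete_kkl.

From mathcomp Require Import all_classical all_reals all_analysis.
From mathcomp Require Import measurable_realfun.
Local Open Scope classical_set_scope.
Local Open Scope ereal_scope.

(** * Product probabilities and fibres *)

Section restriction.
Context d (T : measurableType d) (R : realType) (P : probability T R).

Lemma measurable_box (I : finType) (B : I -> set T) : (forall i, measurable (B i)) ->
  measurable [set w : config I T | forall i, B i (w i)].
Proof.
move=> mB; rewrite (_ : mkset _ = \bigcap_(i in [set: I]) (fun w => w i) @^-1` B i).
  apply: fin_bigcap_measurable => [|i _]; first exact: finite_finset.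
  by rewrite -[_ @^-1` _]setTI; exact: measurable_coordinate.
by apply/seteqP; split=> w /= H i => [_|]; exact: H.
Qed.

Section restriction_map.
Context {I J : finType} (h : I -> J).

Definition subconfig (X : config J T) : config I T := fun i => X (h i).

Lemma measurable_subconfig : measurable_fun setT subconfig.
Proof. by apply: measurable_fun_config => i; exact: measurable_coordinate. Qed.

HB.instance Definition _ :=
  isMeasurableFun.Build _ _ _ _ subconfig measurable_subconfig.

(** By [power_unique] it is enough to treat boxes. A box on [I] pulls back to a box on [J] whose
    sides off the image of [h] are full and have probability 1. *)
Lemma power_subconfig A : injective h -> measurable A ->
  power P J (subconfig @^-1` A) = power P I A.
Proof.
move=> hinj; apply: (power_unique (Q := distribution (power P J) subconfig)) => B mB.
pose B' j := if [pick i | h i == j] is Some i then B i else setT.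
have B'h i : B' (h i) = B i.
  by rewrite /B'; case: pickP => [i' /eqP/hinj ->|/(_ i)]; rewrite ?eqxx.
transitivity (power P J [set X | forall j, B' j (X j)]).
  congr (power P J _); apply/seteqP; split=> X /= H.
    by move=> j; rewrite /B'; case: pickP => [i /eqP <-|//]; exact: H.
  by move=> i; have := H (h i); rewrite B'h.
rewrite power_box => [|j]; last by rewrite /B'; case: pickP.
rewrite (bigID (mem (codom h)))/= [X in _ * X]big1 ?mule1 => [|j jh]; last first.
  rewrite /B'; case: pickP => [i /eqP ij|_]; last exact: probability_setT.
  by rewrite -ij codom_f in jh.
rewrite -big_uniq; last exact/injectiveP.
rewrite /codom /image_mem big_map big_enum/=.
by apply: eq_bigr => i _; rewrite B'h.
Qed.

End restriction_map.

Section join.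
Context {I J : finType}.

Definition config_join (x : config I T * config J T) : config (I + J)%type T :=
  fun k => match k with inl i => x.1 i | inr j => x.2 j end.

Lemma measurable_join : measurable_fun setT config_join.
Proof.
apply: measurable_fun_config => -[i|j].
  by apply: (measurableT_comp (measurable_coordinate i)); exact: measurable_fst.
by apply: (measurableT_comp (measurable_coordinate j)); exact: measurable_snd.
Qed.

HB.instance Definition _ := isMeasurableFun.Build _ _ _ _ config_join measurable_join.

Lemma power_join A : measurable A ->
  (power P I \x power P J) (config_join @^-1` A) = power P (I + J)%type A.
Proof.
apply: (power_unique (Q := distribution (power P I \x power P J) config_join)) => B mB.
rewrite -[LHS]/((power P I \x power P J) (config_join @^-1` [set w | forall i, B i (w i)])).
rewrite (_ : _ @^-1` _ = [set x | forall i, B (inl i) (x i)] `*`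
                         [set y | forall j, B (inr j) (y j)]).
  have mB1 : measurable [set x : config I T | forall i, B (inl i) (x i)].
    by apply: (measurable_box (B := fun i => B (inl i))) => i.
  have mB2 : measurable [set y : config J T | forall j, B (inr j) (y j)].
    by apply: (measurable_box (B := fun j => B (inr j))) => j.
  have p1 : power P I [set x : config I T | forall i, B (inl i) (x i)] =
    \prod_i P (B (inl i)) := power_box P (fun i => mB (inl i)).
  have p2 : power P J [set y : config J T | forall j, B (inr j) (y j)] =
    \prod_j P (B (inr j)) := power_box P (fun j => mB (inr j)).
  by rewrite product_measure1E// big_sumType/=; congr (_ * _); [exact: p1|exact: p2].
apply/seteqP; split=> -[x y] /=.
  by move=> H; split=> [i|j]; [exact: (H (inl i))|exact: (H (inr j))].
by move=> [H1 H2] [i|j]; [exact: H1|exact: H2].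
Qed.

End join.

Lemma measurable_subconfig_preimage (I J : finType) (h : I -> J) A :
  measurable A -> measurable (subconfig h @^-1` A).
Proof. by move=> mA; rewrite -[_ @^-1` _]setTI; exact: measurable_subconfig. Qed.

(** [h1] and [h2] glue to one injection of [I1 + I2], and the marginal along it is a product measure
    by [power_join]. *)
Lemma power_indep (I1 I2 J : finType) (h1 : I1 -> J) (h2 : I2 -> J) A1 A2 :
  injective h1 -> injective h2 -> (forall i j, h1 i != h2 j) ->
  measurable A1 -> measurable A2 ->
  power P J ((subconfig h1 @^-1` A1) `&` (subconfig h2 @^-1` A2)) =
  power P I1 A1 * power P I2 A2.
Proof.
move=> h1_inj h2_inj h12 mA1 mA2.
pose h (k : I1 + I2) := match k with inl i => h1 i | inr j => h2 j end.
have h_inj : injective h.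
  move=> [i|i] [j|j] /= hE; [by congr inl; exact: h1_inj| | |by congr inr; exact: h2_inj].
    by have := h12 i j; rewrite hE eqxx.
  by have := h12 j i; rewrite hE eqxx.
pose A := (subconfig (fun i : I1 => inl i : (I1 + I2)%type) @^-1` A1) `&`
          (subconfig (fun j : I2 => inr j : (I1 + I2)%type) @^-1` A2).
have mA : measurable A.
  by apply: measurableI; exact: measurable_subconfig_preimage.
rewrite -(product_measure1E (power P I1) (power P I2))//.
rewrite (_ : A1 `*` A2 = config_join (I:=I1) (J:=I2) @^-1` A)// power_join//.
by rewrite -(power_subconfig h_inj).
Qed.

Section fill.
Context {E : finType} (e : E).
Local Notation others := {f : E | f != e}.

(** For fixed [psi], the map from [t] to [fill (psi, t)] parametrises the fibre of [psi]. *)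
Definition fill (x : config others T * T) : config E T :=
  fun f => if insub f is Some g then x.1 g else x.2.

Lemma fill_at x : fill x e = x.2.
Proof. by rewrite /fill insubF// eqxx. Qed.

Lemma fill_val x (g : others) : fill x (val g) = x.1 g.
Proof. by rewrite /fill valK. Qed.

Lemma config_split (Q : E -> Prop) : Q e -> (forall g : others, Q (val g)) ->
  forall f, Q f.
Proof.
move=> Qe Qg f; have [->//|fe] := eqVneq f e.
exact: (Qg (exist _ f fe)).
Qed.

Lemma measurable_fill : measurable_fun setT fill.
Proof.
apply: measurable_fun_config => f; rewrite /fill; case: insubP => [g _ _|_].
  by apply: (measurableT_comp (measurable_coordinate g)); exact: measurable_fst.
exact: measurable_snd.
Qed.

HB.instance Definition _ := isMeasurableFun.Build _ _ _ _ fill measurable_fill.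

Lemma measurable_fill_preimage A : measurable A -> measurable (fill @^-1` A).
Proof. by move=> mA; rewrite -[_ @^-1` _]setTI; exact: measurable_fill. Qed.

Lemma power_fill A : measurable A ->
  (power P others \x P) (fill @^-1` A) = power P E A.
Proof.
apply: (power_unique (Q := distribution (power P others \x P) fill)) => B mB.
rewrite -[LHS]/((power P others \x P) (fill @^-1` [set w | forall f, B f (w f)])).
rewrite (_ : _ @^-1` _ = [set psi | forall g : others, B (val g) (psi g)] `*` B e).
  rewrite product_measure1E//; last first.
    by apply: (measurable_box (B := fun g : others => B (val g))) => g.
  rewrite [RHS](bigD1 e)//= muleC; congr (_ * _).
  apply: etrans (power_box P (fun g : others => mB (val g))) _.
  by rewrite (big_sub (fun f => f != e) (fun f => P (B f))).
apply/seteqP; split=> -[psi t] /=.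
  move=> H; split=> [g|]; first by have := H (val g); rewrite fill_val.
  by have := H e; rewrite fill_at.
move=> [H1 H2]; apply: config_split; first by rewrite fill_at.
by move=> g; rewrite fill_val; exact: H1.
Qed.

(** Turns the image in [fibre_prob] into a section in a binary product, where measurability of
    sections and Fubini apply once [A] is measurable. *)
Lemma fibre_probE (A : set (config E T)) (psi : config others T) :
  fibre_prob P A psi = P (xsection (fill @^-1` A) psi).
Proof.
rewrite /fibre_prob; congr (P _); apply/seteqP; split=> t.
  move=> [w [Aw wpsi] <-]; rewrite /xsection/= inE/=.
  suff -> : fill (psi, w e) = w by [].
  apply/funext; apply: config_split; first by rewrite fill_at.
  by move=> g; rewrite fill_val; exact/esym/wpsi.
rewrite /xsection/= inE/= => At; exists (fill (psi, t)); last by rewrite fill_at.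
by split=> // g; rewrite fill_val.
Qed.

Lemma measurable_fibre_prob A : measurable A ->
  measurable_fun setT (@fibre_prob d T R P E A e).
Proof.
move=> mA; rewrite (_ : @fibre_prob _ _ _ _ _ _ _ = P \o xsection (fill @^-1` A)); last first.
  by apply/funext => psi; exact: fibre_probE.
apply: measurable_fun_xsection; exact: measurable_fill_preimage.
Qed.

Lemma fibre_probC A (psi : config others T) : measurable A ->
  fibre_prob P (~` A) psi = 1 - fibre_prob P A psi.
Proof.
move=> mA; rewrite !fibre_probE -probability_setC; first by rewrite !xsectionE.
apply: measurable_xsection; exact: measurable_fill_preimage.
Qed.

(** Exceptional points: a sample falling here could make a fibre of probability 0 look sensitive. *)
Definition zero_fibres (A : set (config E T)) : set (config E T) :=
  A `&` subconfig (val : others -> E) @^-1` [set psi | fibre_prob P A psi = 0].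

Lemma measurable_zero_fibres A : measurable A -> measurable (zero_fibres A).
Proof.
move=> mA; apply: measurableI => //; apply: measurable_subconfig_preimage.
rewrite -[mkset _]setTI.
exact: (measurable_fibre_prob mA measurableT (emeasurable_set1 0)).
Qed.

(** By Fubini: the section at [psi] is either empty or the section of [A], which is null for that
    [psi]. *)
Lemma power_zero_fibres A : measurable A -> power P E (zero_fibres A) = 0.
Proof.
move=> mA; rewrite -power_fill; last exact: measurable_zero_fibres.
rewrite /product_measure1/=; apply: integral0_eq => psi _.
have gpsi t : subconfig (val : others -> E) (fill (psi, t)) = psi.
  by apply/funext => g; rewrite /subconfig fill_val.
have [p0|pN0] := pselect (fibre_prob P A psi = 0).
  rewrite -[RHS]p0 fibre_probE; congr (P _); apply/seteqP; split=> t;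
    rewrite /xsection/= !inE/=; first by case.
  by move=> At; split=> //=; rewrite gpsi.
rewrite (_ : xsection _ _ = set0) ?measure0//.
by apply/seteqP; split=> t //; rewrite /xsection/= inE/= => -[_]; rewrite /= gpsi.
Qed.

End fill.
End restriction.

(** * Sampling *)

Section finite_model.
Context d (Om : measurableType d) (R : realType) (mu : probability Om R).
Context (N : finType) (S : N -> set Om).
Hypothesis mS : forall n, measurable (S n).

Definition pattern (X : Om) : {ffun N -> bool} := [ffun n => X \in S n].

(** The law of [pattern], on a finite type: expectations that depend only on the events [S n] become
    finite sums. *)
Definition pattern_weight (v : {ffun N -> bool}) : R :=
  fine (mu (pattern @^-1` [set v])).

Lemma measurable_pattern v : measurable (pattern @^-1` [set v]).
Proof.
rewrite (_ : _ @^-1` _ = \bigcap_(n in [set: N]) (if v n then S n else ~` S n)).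
  apply: fin_bigcap_measurable => [|n _]; first exact: finite_finset.
  by case: (v n) => //; exact: measurableC.
apply/seteqP; split=> X /=.
  by move=> <- n _; rewrite ffunE; case: ifPn; rewrite ?inE ?notin_setE.
move=> H; apply/ffunP => n; rewrite ffunE; have := H n I.
by case: (v n) => /= Sn; [rewrite mem_set|rewrite memNset].
Qed.

Lemma pattern_weight_ge0 v : (0 <= pattern_weight v)%R.
Proof. exact: fine_ge0. Qed.

Lemma pattern_weightE v : mu (pattern @^-1` [set v]) = (pattern_weight v)%:E.
Proof. by rewrite fineK// fin_num_measure//; exact: measurable_pattern. Qed.

Lemma measure_pattern W : measurable W ->
  mu W = \sum_v mu (pattern @^-1` [set v] `&` W).
Proof.
move=> mW.
rewrite [in LHS](_ : W = \bigcup_(v in [set: {ffun N -> bool}]) (pattern @^-1` [set v] `&` W)).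
  rewrite measure_fin_bigcup.
  - rewrite (_ : [set: _] = [set` index_enum {ffun N -> bool}]).
      by rewrite -fsbig_seq// index_enum_uniq.
    by apply/seteqP; split => v //= _; rewrite mem_index_enum.
  - exact: finite_finset.
  - by move=> v w _ _ [X] /= [[<- _] [<- _]].
  - by move=> v _; exact: (measurableI _ _ (measurable_pattern v) mW).
by apply/seteqP; split=> X => [WX|[v _ []]//]; exists (pattern X).
Qed.

Lemma sum_pattern_weight : (\sum_v pattern_weight v = 1)%R.
Proof.
apply: EFin_inj; rewrite -sumEFin -(@probability_setT _ _ _ mu) (measure_pattern measurableT).
by apply: eq_bigr => v _; rewrite setIT pattern_weightE.
Qed.

Lemma pattern_joint n m :
  ((\sum_v pattern_weight v * (v n && v m)%:R)%R)%:E = mu (S n `&` S m).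
Proof.
rewrite (measure_pattern (measurableI _ _ (mS n) (mS m))) -sumEFin; apply: eq_bigr => v _.
have [/andP[vn vm]|vnm] := boolP (v n && v m); rewrite ?mulr1 ?mulr0.
  rewrite -pattern_weightE; congr (mu _); apply/seteqP; split=> X /=; last by case.
  by move=> Xv; move: vn vm; rewrite -Xv !ffunE !inE.
rewrite (_ : _ `&` _ = set0) ?measure0//; apply/seteqP; split=> X //= [Xv [Sn Sm]].
by move: vnm; rewrite -Xv !ffunE !mem_set.
Qed.

(** Lets an almost sure statement be used for every pattern that counts in a weighted sum. *)
Lemma pattern_weight_neq0 v (Nul : set Om) : mu.-negligible Nul ->
  pattern_weight v != 0%R -> exists2 X, ~ Nul X & pattern X = v.
Proof.
move=> [Nul' [mNul' Nul'0 NulNul']] pv; apply: contrapT => H; move/eqP: pv; apply.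
rewrite /pattern_weight; suff -> : mu (pattern @^-1` [set v]) = 0 by [].
apply: (subset_measure0 (measurable_pattern v) mNul') => // X /= Xv.
by apply: NulNul'; apply: contrapT => NX; apply: H; exists X.
Qed.

End finite_model.

Lemma negligible_exists d (Om : measurableType d) (R : realType)
    (mu : {measure set Om -> \bar R}) (I : countType) (G : I -> set Om) :
  (forall i, mu.-negligible (G i)) -> mu.-negligible [set X | exists i, G i X].
Proof.
move=> G0; pose F n := if unpickle n is Some i then G i else set0.
apply: (negligibleS (A := \bigcup_n F n)) => [X [i GX]|].
  by exists (pickle i) => //; rewrite /F pickleK.
apply: negligible_bigcup => n; rewrite /F.
by case: unpickle => [i|]; [exact: G0|exact: negligible_set0].
Qed.

(** * Moments of the density of a random subset of the grid *)

Section second_moment.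
Context {R : realFieldType} {E L V : finType}.
Local Notation Z := {ffun E -> L}.

Definition clash (z w : Z) : bool := [exists e, z e == w e].

(** For fixed [z] and [e], resampling [w] at [e] makes it agree with [z] for one letter out of
    [#|L|]; a union bound over [e] concludes. *)
Lemma sum_clash : (#|L| * \sum_z \sum_w clash z w <= #|E| * (#|{: Z}| * #|{: Z}|))%N.
Proof.
rewrite big_distrr/=.
have -> : (#|E| * (#|{: Z}| * #|{: Z}|) = \sum_(z : Z) (#|E| * #|{: Z}|))%N.
  by rewrite sum_nat_const mulnCA.
apply: leq_sum => z _.
apply: (@leq_trans (#|L| * \sum_(w : Z) \sum_e (z e == w e))%N).
  rewrite leq_mul2l; apply/orP; right; apply: leq_sum => w _.
  rewrite /clash; case: existsP => // -[e ze].
  by rewrite (bigD1 e)//= ze.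
rewrite exchange_big/= big_distrr/= -sum_nat_const; apply: leq_sum => e _.
rewrite -(sum_update (fun w : Z => (z e == w e) : nat) e).
rewrite -sum1_card; apply: leq_sum => w _.
rewrite (bigD1 (z e))//= update_same eqxx big1 ?addn0// => l /negPf lz.
by rewrite update_same eq_sym lz.
Qed.

(** [ps2] encodes independence of points without a common coordinate, with an error 1 for clashing
    pairs. The setting serves both the sampled event and, for each [e], the sampled nontrivial
    fibres. *)
Variables (p : V -> R) (b : V -> Z -> bool) (s : R).
Hypothesis p1 : (\sum_v p v = 1)%R.
Hypothesis ps : forall z, (\sum_v p v * (b v z)%:R = s)%R.
Hypothesis ps2 : forall z w,
  (\sum_v p v * (b v z && b v w)%:R <= s ^+ 2 + (clash z w)%:R)%R.
Hypothesis L0 : (0 < #|L|)%N.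

Let density v : R := avg (fun z => (b v z)%:R).

Let Z0 : #|{: Z}|%:R != 0%R :> R.
Proof. by rewrite pnatr_eq0 card_ffun expn_eq0 negb_and -lt0n L0. Qed.

Let sum_cst (c : R) : (\sum_(z : Z) c = c * #|{: Z}|%:R)%R.
Proof. by rewrite sumr_const mulr_natr. Qed.

Lemma mean_density : (\sum_v p v * density v = s)%R.
Proof.
rewrite /density /avg; under eq_bigr do rewrite mulrA mulr_sumr.
rewrite -mulr_suml exchange_big/= (eq_bigr (fun=> s)) => [|z _]; last exact: ps.
by rewrite sum_cst mulfK.
Qed.

(** The squared density is an average over pairs of points, and by [sum_clash] the proportion of
    clashing pairs is at most [#|E| / #|L|]. *)
Lemma second_moment_density :
  (\sum_v p v * density v ^+ 2 <= s ^+ 2 + #|E|%:R / #|L|%:R)%R.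
Proof.
have -> : (\sum_v p v * density v ^+ 2 =
  (\sum_z \sum_w \sum_v p v * (b v z && b v w)%:R) / #|{: Z}|%:R ^+ 2)%R.
  under [in RHS]eq_bigr do rewrite exchange_big/=.
  rewrite exchange_big/= mulr_suml; apply: eq_bigr => v _.
  rewrite /density /avg expr_div_n mulrA; congr (_ / _)%R.
  rewrite expr2 mulr_suml mulr_sumr; apply: eq_bigr => z _.
  rewrite !mulr_sumr; apply: eq_bigr => w _.
  by rewrite -natrM mulnb.
have Zpos : (0 < #|{: Z}|%:R :> R)%R by rewrite lt0r Z0 ler0n.
rewrite ler_pdivrMr ?exprn_gt0// mulrDl.
apply: (@le_trans _ _ (\sum_(z : Z) \sum_(w : Z) (s ^+ 2 + (clash z w)%:R))%R).
  by apply: ler_sum => z _; apply: ler_sum => w _; exact: ps2.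
under eq_bigr do rewrite big_split/=.
rewrite big_split/= lerD//.
  under eq_bigr do rewrite sum_cst.
  by rewrite sum_cst -mulrA -expr2.
rewrite mulrAC ler_pdivlMr ?ltr0n//.
rewrite (_ : (\sum_z _)%R = (\sum_z \sum_w clash z w)%N%:R); last first.
  by rewrite natr_sum; apply: eq_bigr => z _; rewrite natr_sum.
by rewrite mulrC -natrX -!natrM ler_nat sum_clash.
Qed.

End second_moment.

(** * Transfer from the sampled grid to the product space *)

Section sampling.
Context d (T : measurableType d) (R : realType) (P : probability T R).
Context (E : finType) (A : set (config E T)).
Hypothesis mA : measurable A.
Local Notation others e := {f : E | f != e}.
Let a := fine (power P E A).
Let I e := fine (influence P A e).

Definition nontrivial_fibres e : set (config (others e) T) :=
  [set psi | 0 < fibre_prob P A psi < 1].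
Arguments nontrivial_fibres : clear implicits.

Lemma measurable_nontrivial_fibres e : measurable (nontrivial_fibres e).
Proof.
rewrite -[nontrivial_fibres e]setTI.
rewrite (_ : nontrivial_fibres e = @fibre_prob _ _ _ P _ A e @^-1` `]0, 1[%classic).
  exact: (measurable_fibre_prob P mA measurableT (emeasurable_itv _)).
by apply/seteqP; split=> psi /=; rewrite in_itv.
Qed.

Lemma measurable_zero_fibresU e :
  measurable (zero_fibres P e A `|` zero_fibres P e (~` A)).
Proof.
by apply: measurableU; apply: measurable_zero_fibres => //; exact: measurableC.
Qed.

Lemma power_zero_fibresU e :
  power P E (zero_fibres P e A `|` zero_fibres P e (~` A)) = 0.
Proof.
apply/negligibleP; first exact: measurable_zero_fibresU.
have zero B : measurable B -> (power P E).-negligible (zero_fibres P e B).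
  move=> mB; apply/negligibleP; last exact: power_zero_fibres.
  exact: (measurable_zero_fibres P e mB).
by apply: negligibleU; apply: zero => //; apply: measurableC.
Qed.

Section sample_size.
Variable k : nat.
Local Notation L := {ffun 'I_k -> bool}.
Local Notation Z := {ffun E -> {ffun 'I_k -> bool}}.
Local Notation mu := (power P (E * {ffun 'I_k -> bool})%type).

(** A configuration over [E * L] holds [#|L|] independent draws of every coordinate; [z] selects the
    draw numbered [z e] for [e]. *)
Definition sample (z : Z) (e : E) : E * L := (e, z e).

Lemma sample_inj z : injective (sample z).
Proof. by move=> e f []. Qed.

Lemma sample_disjoint z w : ~~ clash z w -> forall e f, sample z e != sample w f.
Proof.
move=> /existsPn zw e f; rewrite /sample xpair_eqE.
by have [<-|//] := eqVneq e f; exact: zw.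
Qed.

(** One finite family records the event ([inl]) and the nontrivial fibres ([inr]), so a single
    pattern determines the random set and the bounds on its influences. *)
Definition sample_event (n : Z + E * Z) : set (config (E * L)%type T) :=
  match n with
  | inl z => subconfig (sample z) @^-1` A
  | inr (e, z) => subconfig (fun g : others e => sample z (val g)) @^-1` nontrivial_fibres e
  end.

Lemma measurable_sample_event n : measurable (sample_event n).
Proof.
case: n => [z|[e z]]; apply: measurable_subconfig_preimage => //.
exact: measurable_nontrivial_fibres.
Qed.

Definition sample_null : set (config (E * L)%type T) :=
  [set X | exists i : E * Z, (subconfig (sample i.2) @^-1`
    (zero_fibres P i.1 A `|` zero_fibres P i.1 (~` A))) X].

Lemma sample_null_negligible : mu.-negligible sample_null.
Proof.
apply: negligible_exists => -[e z].
have mB := measurable_zero_fibresU e.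
apply/(negligibleP mu (measurable_subconfig_preimage (sample z) mB)).
exact: etrans (power_subconfig P (@sample_inj z) mB) (power_zero_fibresU e).
Qed.

Lemma subconfig_update (X : config (E * L)%type T) z e l :
  subconfig (val : others e -> E) (subconfig (sample (update z e l)) X) =
  subconfig (fun g : others e => sample z (val g)) X.
Proof.
apply/funext => g; rewrite /subconfig /sample update_other//.
exact: valP g.
Qed.

(** The fibre [psi] depends only on the draws off [e], so all [update z e l] share it. If it is
    trivial, then outside [sample_null] these points are all outside [A] (probability 0) or all
    inside (probability 1). *)
Lemma sensitive_nontrivial X e z : ~ sample_null X ->
  sensitive [set z | X \in sample_event (inl z)]%SET e z ->
  X \in sample_event (inr (e, z)).
Proof.
move=> nullX; apply: contraTT => /negP trivX; apply/insensitiveP => l.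
pose psi := subconfig (fun g : others e => sample z (val g)) X.
have psi_update w : w = z \/ w = update z e l ->
    subconfig (val : others e -> E) (subconfig (sample w) X) = psi.
  by move=> [->//|->]; exact: subconfig_update.
have in_or_out (w : Z) : w = z \/ w = update z e l ->
    (A (subconfig (sample w) X) -> fibre_prob P A psi <> 0) /\
    (~ A (subconfig (sample w) X) -> fibre_prob P (~` A) psi <> 0).
  by move=> wz; split=> Aw p0; apply: nullX; exists (e, w); [left|right];
    split=> //; rewrite /preimage/= psi_update.
have mS : measurable (xsection (fill (e:=e) @^-1` A) psi).
  by apply: measurable_xsection; exact: measurable_fill_preimage.
have p_ge0 : 0 <= fibre_prob P A psi by rewrite fibre_probE.
have p_le1 : fibre_prob P A psi <= 1 by rewrite fibre_probE probability_le1.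
have p01 : fibre_prob P A psi = 0 \/ fibre_prob P A psi = 1.
  have [|p0] := eqVneq (fibre_prob P A psi) 0; first by left.
  have [|p1] := eqVneq (fibre_prob P A psi) 1; first by right.
  exfalso; apply: trivX; rewrite inE; change (0 < fibre_prob P A psi < 1).
  by rewrite !lt_neqAle p_ge0 p_le1 p1 eq_sym p0.
rewrite !inE.
have same w : w = z \/ w = update z e l ->
   (subconfig (sample w) X \in A) = (fibre_prob P A psi == 1).
  move=> wz; have [Hin Hout] := in_or_out w wz; apply/idP/eqP.
    by rewrite inE => /Hin p0; case: p01.
  move=> p1; rewrite inE; apply: contrapT => /Hout.
  by rewrite fibre_probC// p1 subee.
by rewrite [LHS](same _ (or_intror erefl)) [RHS](same _ (or_introl erefl)).
Qed.

Section moments.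
Context (K : finType) (h : Z -> K -> E * L) (B : set (config K T)) (n : Z -> Z + E * Z).
Hypothesis h_inj : forall z, injective (h z).
Hypothesis h_disj : forall z w, ~~ clash z w -> forall i j, h z i != h w j.
Hypothesis mB : measurable B.
Hypothesis nE : forall z, sample_event (n z) = subconfig (h z) @^-1` B.

Let p := pattern_weight mu sample_event.
Let s := fine (power P K B).

Let sE : s%:E = power P K B.
Proof. by rewrite fineK// fin_num_measure. Qed.

Lemma sample_mean z : (\sum_v p v * (v (n z))%:R = s)%R.
Proof.
apply: EFin_inj; rewrite sE -(power_subconfig P (h_inj (z:=z)) mB) -nE.
rewrite -[X in mu X]setIid -(pattern_joint mu measurable_sample_event).
by congr EFin; apply: eq_bigr => v _; rewrite andbb.
Qed.

(** Clashing pairs are bounded by the total weight 1; the others use disjoint sets of draws, so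
    [power_indep] applies. *)
Lemma sample_second_moment z w :
  (\sum_v p v * (v (n z) && v (n w))%:R <= s ^+ 2 + (clash z w)%:R)%R.
Proof.
have [_|zw] := boolP (clash z w).
  apply: (@le_trans _ _ 1%R); last by rewrite lerDr sqr_ge0.
  rewrite -[leRHS](sum_pattern_weight mu measurable_sample_event); apply: ler_sum => v _.
  by apply: ler_piMr; [exact: pattern_weight_ge0|case: (_ && _)].
rewrite addr0 -lee_fin (pattern_joint mu measurable_sample_event) !nE.
by rewrite power_indep// ?EFinM ?sE//; exact: h_disj.
Qed.

End moments.

(** [discrete_kkl] averaged over the patterns: both sides are quadratic in the densities, and each
    second moment costs an error [#|E| / 2 ^ k]. *)
Lemma sample_kkl D (lam : R) : (0 < D)%N -> (0 < lam)%R ->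
  (a - (a ^+ 2 + #|E|%:R / (2 ^ k)%:R) <=
   (2 * D%:R)^-1 * (\sum_e I e) +
   3 ^+ D / 2 * \sum_e (lam * I e + (I e ^+ 2 + #|E|%:R / (2 ^ k)%:R) / lam))%R.
Proof.
move=> D0 lam0.
have cardL : #|{: L}| = (2 ^ k)%N by rewrite card_ffun card_bool card_ord.
have L0 : (0 < #|{: L}|)%N by rewrite cardL expn_gt0.
pose p := pattern_weight mu sample_event.
have p1 : (\sum_v p v = 1)%R := sum_pattern_weight mu measurable_sample_event.
have p0 v : (0 <= p v)%R := pattern_weight_ge0 mu sample_event v.
pose f (v : {ffun Z + E * Z -> bool}) := avg (fun z => (v (inl z))%:R) : R.
pose J (v : {ffun Z + E * Z -> bool}) e := avg (fun z => (v (inr (e, z)))%:R) : R.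
have f_mean : (\sum_v p v * f v = a)%R.
  apply: mean_density => // z.
  exact: (sample_mean (h := sample) (n := inl) sample_inj mA).
have f_sq : (\sum_v p v * f v ^+ 2 <= a ^+ 2 + #|E|%:R / (2 ^ k)%:R)%R.
  rewrite -cardL; apply: second_moment_density => // z w.
  exact: (sample_second_moment (h := sample) (n := inl) sample_inj sample_disjoint mA).
pose h e z (g : others e) := sample z (val g).
have h_inj e z : injective (h e z) by move=> g g' /sample_inj/val_inj.
have h_disj e z w : ~~ clash z w -> forall g g', h e z g != h e w g'.
  by move=> zw g g'; exact: sample_disjoint.
have mN e := measurable_nontrivial_fibres e.
have J_mean e : (\sum_v p v * J v e = I e)%R.
  apply: mean_density => // z.
  exact: (sample_mean (h := h e) (n := fun z => inr (e, z)) (h_inj e) (mN e)).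
have J_sq e : (\sum_v p v * J v e ^+ 2 <= I e ^+ 2 + #|E|%:R / (2 ^ k)%:R)%R.
  rewrite -cardL; apply: second_moment_density => // z w.
  exact: (sample_second_moment (h := h e) (n := fun z => inr (e, z)) (h_inj e) (h_disj e) (mN e)).
have J_ge0 v e : (0 <= J v e)%R by apply: avg_ge0 => z; exact: ler0n.
have kkl v : (p v * (f v - f v ^+ 2) <= p v * ((2 * D%:R)^-1 * (\sum_e J v e) +
   3 ^+ D / 2 * \sum_e (lam * J v e + J v e ^+ 2 / lam)))%R.
  have [->|pv] := eqVneq (p v) 0%R; first by rewrite !mul0r.
  rewrite ler_wpM2l//.
  (* A representative outside the null set realises [v] as an actual subset [G] of the grid, whose
     influences are dominated by [J v]. *)
  have [X nullX Xv] := pattern_weight_neq0 measurable_sample_event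
    sample_null_negligible pv.
  pose G : {set Z} := [set z | X \in sample_event (inl z)]%SET.
  have fE : f v = (#|G|%:R / #|{: Z}|%:R)%R.
    rewrite /f /avg card_sum natr_sum; congr (_ / _)%R; apply: eq_bigr => z _.
    by rewrite inE -Xv ffunE.
  have JG e : (discrete_influence R G e <= J v e)%R.
    apply: le_avg => z; rewrite ler_nat -Xv ffunE.
    case: (boolP (sensitive G e z)) => // /(sensitive_nontrivial nullX) -> //.
  rewrite fE; apply: le_trans (discrete_kkl G D0 lam0) _.
  rewrite lerD// ler_wpM2l ?invr_ge0 ?divr_ge0 ?exprn_ge0 ?mulr_ge0//; apply: ler_sum => e _ //.
  apply: lerD; first by rewrite ler_wpM2l// ltW.
  rewrite ler_wpM2r ?invr_ge0 ?(ltW lam0)//.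
  by rewrite ler_sqr ?nnegrE// discrete_influence_ge0.
have : (\sum_v p v * (f v - f v ^+ 2) <= \sum_v p v * ((2 * D%:R)^-1 * (\sum_e J v e) +
   3 ^+ D / 2 * \sum_e (lam * J v e + J v e ^+ 2 / lam)))%R.
  by apply: ler_sum => v _; exact: kkl.
have -> : (\sum_v p v * (f v - f v ^+ 2) = a - \sum_v p v * f v ^+ 2)%R.
  by rewrite -f_mean -sumrB; apply: eq_bigr => v _; rewrite mulrBr.
have -> : (\sum_v p v * ((2 * D%:R)^-1 * (\sum_e J v e) +
   3 ^+ D / 2 * \sum_e (lam * J v e + J v e ^+ 2 / lam)) =
   (2 * D%:R)^-1 * (\sum_e I e) +
   3 ^+ D / 2 * \sum_e (lam * I e + (\sum_v p v * J v e ^+ 2) / lam))%R.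
  under eq_bigr do rewrite mulrDr.
  rewrite big_split/=; congr (_ + _)%R.
    under eq_bigr do rewrite mulrCA mulr_sumr.
    rewrite -mulr_sumr exchange_big/=; congr (_ * _)%R; apply: eq_bigr => e _.
    exact: J_mean.
  under eq_bigr do rewrite mulrCA mulr_sumr.
  rewrite -mulr_sumr exchange_big/=; congr (_ * _)%R; apply: eq_bigr => e _.
  rewrite -J_mean mulr_sumr mulr_suml -big_split/=; apply: eq_bigr => v _.
  ring.
move=> H; apply: le_trans (le_trans H _); first by rewrite lerB.
rewrite lerD2l ler_wpM2l ?divr_ge0 ?exprn_ge0//; apply: ler_sum => e _.
by rewrite lerD2l ler_wpM2r ?invr_ge0 ?(ltW lam0).
Qed.

End sample_size.

(** The errors in [sample_kkl] add up to [C / 2 ^ k], which for large [k] is below any positive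
    gap. *)
Lemma kkl_parametric D (lam : R) : (0 < D)%N -> (0 < lam)%R ->
  (a - a ^+ 2 <= (2 * D%:R)^-1 * (\sum_e I e) +
   3 ^+ D / 2 * \sum_e (lam * I e + I e ^+ 2 / lam))%R.
Proof.
move=> D0 lam0; set rhs := (X in (_ <= X)%R).
rewrite leNgt; apply/negP => lt_rhs.
pose C : R := (#|E|%:R + 3 ^+ D / 2 * (#|E|%:R * (#|E|%:R / lam)))%R.
have C0 : (0 <= C)%R.
  by rewrite addr_ge0// !mulr_ge0 ?exprn_ge0 ?invr_ge0 ?(ltW lam0).
have bound k : (a - a ^+ 2 <= rhs + C / (2 ^ k)%:R)%R.
  have := sample_kkl k D0 lam0; rewrite /=.
  set x := (#|E|%:R / (2 ^ k)%:R)%R => H.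
  suff -> : (rhs + C / (2 ^ k)%:R = (2 * D%:R)^-1 * (\sum_e I e) +
     3 ^+ D / 2 * \sum_e (lam * I e + (I e ^+ 2 + x) / lam) + x)%R.
    by move: H; rewrite opprD addrA lerBlDr.
  have -> : (\sum_e (lam * I e + (I e ^+ 2 + x) / lam) =
      \sum_e (lam * I e + I e ^+ 2 / lam) + #|E|%:R * (x / lam))%R.
    transitivity (\sum_e ((lam * I e + I e ^+ 2 / lam) + x / lam))%R.
      by apply: eq_bigr => e _; rewrite mulrDl addrA.
    by rewrite big_split/= sumr_const mulr_natl.
  rewrite /rhs /C /x; set s1 := (\sum_e I e)%R; set s2 := (\sum_e _)%R.
  ring.
set eps := (a - a ^+ 2 - rhs)%R; have eps0 : (0 < eps)%R by rewrite subr_gt0.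
have [k Ck] : exists k, (C / eps < (2 ^ k)%:R)%R.
  exists (Num.bound (C / eps)); apply: (@lt_trans _ _ (Num.bound (C / eps))%:R)%R.
    by rewrite archi_boundP// divr_ge0// ltW.
  by rewrite ltr_nat ltn_expl.
have := bound k; rewrite -lerBlDl -/eps leNgt => /negP; apply.
by rewrite ltr_pdivrMr ?ltr0n ?expn_gt0// mulrC -ltr_pdivrMr.
Qed.

End sampling.

(** * Choice of the parameters *)

Section optimization.
Context {R : realType}.
Local Open Scope ring_scope.

Lemma expR_bound (L : R) : 0 <= L -> L * expR (- (L / 4)) <= 4.
Proof.
move=> L0; rewrite expRN ler_pdivrMr ?expR_gt0//.
have := expR_ge1Dx (L / 4); lra.
Qed.

(** From [exp 1 >= 2] follows [3 <= exp 2], and [2 * n <= L / 4]. *)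
Lemma expn3_bound (n : nat) (L : R) : n%:R <= L / 8 -> 3 ^+ n <= expR (L / 4).
Proof.
move=> nL; apply: (@le_trans _ _ (expR 2 ^+ n)).
  have e1 := expR_ge1Dx (1 : R).
  rewrite lerXn2r ?nnegrE ?expR_ge0// (_ : 2 = 1 + 1 :> R)// expRD; nra.
by rewrite -expRM_natl ler_expR; lra.
Qed.

(* The choice [lam = sqrt m] and [D = ln (1 / m) / 8 + O(1)]. *)
Lemma optimize_kkl (E : finType) (I : E -> R) (m V : R) :
  0 < m <= 1 -> (forall e, 0 <= I e <= m) ->
  (forall D (lam : R), (0 < D)%N -> 0 < lam ->
    V <= (2 * D%:R)^-1 * (\sum_e I e) +
         3 ^+ D / 2 * \sum_e (lam * I e + I e ^+ 2 / lam)) ->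
  V * ln m^-1 <= 16 * \sum_e I e.
Proof.
move=> /andP[m0 m1] Im H.
set S := \sum_e I e; set L := ln m^-1.
have L0 : 0 <= L by rewrite ln_ge0// invf_ge1.
have S0 : 0 <= S by apply: sumr_ge0 => e _; case/andP: (Im e).
pose lam := expR (- (L / 2)).
have lam0 : 0 < lam by exact: expR_gt0.
have lam2 : lam ^+ 2 = m.
  rewrite -expRM_natl (_ : 2%:R * - (L / 2) = - L); last by field.
  by rewrite expRN lnK ?posrE ?invr_gt0// invrK.
pose n := Num.trunc (L / 8).
have [nL Ln] : n%:R <= L / 8 /\ L / 8 <= n.+1%:R.
  have /andP[? /ltW ?] := Num.Theory.truncn_itv (divr_ge0 L0 (ler0n R 8)).
  by split.
have := H n.+1 lam isT lam0.
(* Since [I e ^ 2 <= m * I e = lam ^ 2 * I e], the quadratic term is at most the linear one. *)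
have S2 : \sum_e (lam * I e + I e ^+ 2 / lam) <= 2 * lam * S.
  rewrite mulr_sumr; apply: ler_sum => e _; have /andP[I0 Ie] := Im e.
  have : I e ^+ 2 / lam <= lam * I e.
    by rewrite ler_pdivrMr// mulrAC -expr2 lam2 expr2 ler_wpM2r.
  lra.
(* Of the two factors [exp (- L / 4)] of [lam], one absorbs [3 ^ n] and the other remains as
   decay. *)
have e3 : 3 ^+ n.+1 * lam <= 3 * expR (- (L / 4)).
  rewrite exprS -mulrA ler_wpM2l// /lam (_ : - (L / 2) = - (L / 4) - L / 4); last by field.
  rewrite expRD mulrCA ler_piMr ?expR_ge0//.
  by rewrite [expR (- (L / 4))]expRN ler_pdivrMr ?expR_gt0// mul1r expn3_bound.
move=> V1; have V2 : V <= ((2 * n.+1%:R)^-1 + 3 * expR (- (L / 4))) * S.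
  apply: le_trans V1 _; rewrite [leRHS]mulrDl lerD2l.
  apply: (@le_trans _ _ (3 ^+ n.+1 / 2 * (2 * lam * S))).
    by rewrite ler_wpM2l// divr_ge0// exprn_ge0.
  by rewrite !mulrA divfK ?pnatr_eq0// ler_wpM2r.
apply: (@le_trans _ _ (((2 * n.+1%:R)^-1 + 3 * expR (- (L / 4))) * S * L)).
  by rewrite ler_wpM2r.
rewrite mulrAC ler_wpM2r// mulrDl.
have := expR_bound L0; have : (2 * n.+1%:R)^-1 * L <= 4.
  rewrite [leLHS]mulrC ler_pdivrMr; last by rewrite mulr_gt0// ltr0n.
  by rewrite (_ : 4 * _ = n.+1%:R * 8); [rewrite -ler_pdivrMr|ring].
rewrite -[3 * _ * L]mulrA (mulrC (expR _)) => hN hL.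
(* The 4 comes from [L <= 8 * n.+1], the [3 * 4] from [expR_bound]. *)
rewrite (_ : 16 = 4 + 3 * 4 :> R); last by ring.
by apply: lerD => //; rewrite ler_wpM2l.
Qed.

End optimization.

(** * Passage to extended reals, with constant 1/16 *)

Theorem theorem2p3 (R : realType) :
  exists2 c : R, (0 < c)%R &
    forall (d : measure_display) (T : measurableType d) (P : probability T R)
      (E : finType) (A : set (config E T)),
      measurable A ->
      0 < power P E A < 1 ->
      c%:E * power P E A * (1 - power P E A) * lne (1 / max_influence P A)
        <= \sum_(e : E) influence P A e.
Proof.
exists (16^-1)%R => [|d T P E A mA]; first by rewrite invr_gt0.
pose a := fine (power P E A); pose I e := fine (influence P A e).
have aE : power P E A = a%:E by rewrite fineK// fin_num_measure.
have IE e : influence P A e = (I e)%:E.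
  by rewrite fineK// fin_num_measure//; exact: measurable_nontrivial_fibres.
have I01 e : (0 <= I e <= 1)%R.
  rewrite -!lee_fin -IE measure_ge0 probability_le1//.
  exact: measurable_nontrivial_fibres.
rewrite aE !lte_fin => /andP[a0 a1].
have kkl D lam D0 lam0 := @kkl_parametric _ _ _ P _ _ mA D lam D0 lam0.
have max_ge0 : 0 <= max_influence P A by exact: bigmax_ge_id.
have max_le1 : max_influence P A <= 1.
  by apply: bigmax_le => // e _; rewrite IE lee_fin; case/andP: (I01 e).
have le_max e : influence P A e <= max_influence P A by exact: le_bigmax.
have [m mE] : exists m, max_influence P A = m%:E.
  exists (fine (max_influence P A)).
  by rewrite fineK// ge0_fin_numE// (le_lt_trans max_le1) ?ltry.
move: max_ge0 max_le1 le_max; rewrite {}mE !lee_fin => m_ge0 m_le1 le_max.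
have Im e : (0 <= I e <= m)%R.
  by have := le_max e; rewrite IE lee_fin => ->; case/andP: (I01 e) => ->.
(* If all influences vanished, in particular if [E] were empty, then [kkl] with [D = 1] and
   [lam = 1] would give [a - a ^ 2 <= 0], against [0 < a < 1]. Positivity of [m] turns the extended
   logarithm into a real one. *)
have m_gt0 : (0 < m)%R.
  rewrite lt_neqAle m_ge0 andbT; apply/eqP => m0.
  have I0 e : I e = 0%R by apply/eqP; rewrite eq_le; have := Im e; rewrite -m0 andbC.
  have := kkl 1%N 1%R isT ltr01; rewrite !big1 => [|e _|e _]; last first.
  - exact: I0.
  - by rewrite -/(I e) I0 expr0n/= mulr0 mul0r addr0.
  rewrite !mulr0 addr0 -/a; nra.
rewrite inver gt_eqF// mul1e lne_EFin ?invr_gt0//.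
under eq_bigr do rewrite IE.
rewrite sumEFin -EFinB -!EFinM lee_fin.
have := optimize_kkl (introT andP (conj m_gt0 m_le1)) Im kkl.
rewrite -/a; set S := (\sum_e _)%R; set l := ln _; nra.
Qed.
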